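(* Let $-\infty\leq a<b\leq\infty$ and let $f:(a,b)\to\mathbb{R}$ be convex. Then for every $\varepsilon_o>0$ and for every continuous function $\varepsilon:(a,b)\to(0,\infty)$ there is a convex function $g\in C^2(a,b)$ such that $$|\{x\in(a,b): f(x)\neq g(x)\}|<\varepsilon_o \quad\text{and}\quad |f(x)-g(x)|<\varepsilon(x)\ \text{ for all } x\in(a,b).$$
   Context: $|A|$ denotes the Lebesgue measure of a set $A\subset\mathbb{R}$. $C^2(a,b)$ is the class of twice continuously differentiable real-valued functions on the open interval $(a,b)$. *)

(* Defs.v *)
From HB Require Import structures.
From mathcomp Require Import all_boot all_order all_algebra.
From mathcomp Require Import all_classical all_reals all_analysis.

Set Implicit Arguments.
Unset Strict Implicit.
Unset Printing Implicit Defensive.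

Import Order.TTheory GRing.Theory Num.Theory.
Import numFieldNormedType.Exports.

Local Open Scope classical_set_scope.
Local Open Scope ring_scope.

(* The interval (a, b) as a set of finite reals; a and b may be infinite. *)
Definition ooitv (R : realType) (a b : \bar R) : set R :=
  [set x | (a < x%:E < b)%E].

(* D is meant to be open: [derivable] and [f^`(n)] are two-sided, so at a point
   of an open D they depend only on the values of f on D. Continuity of f and
   f' on D follows from derivability. *)
Definition C2_on (R : realType) (D : set R) (f : R -> R) : Prop :=
  [/\ {in D, forall x, derivable f x 1},
      {in D, forall x, derivable f^`()%classic x 1} &
      {within D, continuous f^`(2)%classic}].

(* Main.v *)
(* Let h be a subgradient of f; it is nondecreasing, hence derivable almost
   everywhere, and by Egorov's theorem its difference quotients converge
   locally uniformly on a relatively closed set F whose complement has small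
   measure. The function g equals f on F. On a gap ]c, d[ of F one has to find
   w = g'' >= 0 continuous with prescribed values h'(c), h'(d) at the ends and
   such that the integrals of w and of its primitive are those dictated by
   f(c), h(c), f(d), h(d). If h deviates from its first order expansions at
   c and d by at most the slope e, the admissible data lie strictly between
   those of the two bang-bang functions jumping between the levels
   max 0 (h'(c) - 3e) and h'(c) + 3e; smoothing these by piecewise linear
   functions and taking a convex combination gives w with
   |w - h'(c)| <= 3e. As e tends to 0 when gaps shrink to a point of F, the
   glued second derivative is continuous. On a gap f and g differ by at most
   (h(d) - h(c)) (d - c), which is small if the gaps are short. *)
Require Import Defs.
From HB Require Import structures.
From mathcomp Require Import all_boot all_order all_algebra.
From mathcomp Require Import all_classical all_reals all_analysis.
From mathcomp Require Import measurable_realfun ring lra.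

Set Implicit Arguments.
Unset Strict Implicit.
Unset Printing Implicit Defensive.

Import Order.TTheory GRing.Theory Num.Theory.
Import numFieldNormedType.Exports.

Local Open Scope classical_set_scope.
Local Open Scope ring_scope.

(** * Almost everywhere differentiability of monotone functions *)

(** A point of F can be a limit of infinitely many gaps, so derivability of h at each single point
    of F would not make the glued second derivative continuous there: the expansions at both ends of
    all nearby gaps must be good at once. Hence differentiability is required with a base point
    moving in F, and the weight on a gap is tied to a nearly best slope e of that gap.

    Origin of the 3e: the expansion at d has slope h'(d), which is within e of h'(c), so both
    expansions together confine the increments of h to slopes within 2e of h'(c); the third e makes
    the inequalities strict. If h(c) = h(d) the level 0 leaves no room below; then f is affine on
    the gap and w = 0.

    Convexity of g is not read off from the sign of g''. The glued first derivative k is shown to be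
    a subgradient of g, a relation that passes from gap to gap by transitivity. It yields convexity
    and, once k is known to be derivable, also g' = k. No primitive is obtained by integration:
    weights come with explicit primitives, and areas under h are increments of f. *)

Lemma is_derive1_epsP (R : realType) (f : R -> R) (x l : R) :
  is_derive x 1 f l <->
  forall e, 0 < e -> exists2 r, 0 < r &
    forall y, `|y - x| < r -> `|f y - f x - l * (y - x)| <= e * `|y - x|.
Proof.
split=> [[df dfl] e e0|df].
  have : (fun t : R => t^-1 *: (f (t *: (1 : R) + x) - f x)) @ 0^' --> l.
    by move/cvg_ex: df => -[l' df]; rewrite -dfl /derive (cvg_lim _ df).
  move=> /cvgrPdist_le/(_ _ e0); rewrite near_withinE => -[r /= r0 xr].
  exists r => // y yx; have [->|yNx] := eqVneq y x.
    by rewrite !subrr mulr0 subrr !normr0 mulr0.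
  have yx0 : y - x != 0 by rewrite subr_eq0.
  have := xr (y - x); rewrite /= sub0r normrN => /(_ yx yx0).
  rewrite /GRing.scale/= mulr1 subrK => h.
  have -> : f y - f x - l * (y - x) = - (l - (y - x)^-1 * (f y - f x)) * (y - x).
    by field.
  by rewrite normrM normrN ler_wpM2r.
have lim : (fun t : R => t^-1 *: (f (t *: (1 : R) + x) - f x)) @ 0^' --> l.
  apply/cvgrPdist_le => e e0; have [r r0 xr] := df e e0.
  rewrite near_withinE; exists r => //= t /=; rewrite sub0r normrN => tr t0.
  have := xr (t + x); rewrite addrK => /(_ tr).
  rewrite /GRing.scale/= mulr1.
  have -> : f (t + x) - f x - l * t = - (l - t^-1 * (f (t + x) - f x)) * t.
    by field.
  by rewrite normrM normrN ler_pM2r// normr_gt0.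
by apply: DeriveDef; [apply/cvg_ex; exists l|exact: cvg_lim].
Qed.

(** The measure is the restriction of an outer measure that is defined on every set, so monotonicity
    and countable subadditivity need no measurability. Images of null sets and the set where f and g
    differ are therefore never shown to be measurable. *)
Lemma le_lebesgue_measureT (R : realType) (A B : set R) :
  A `<=` B -> (lebesgue_measure A <= lebesgue_measure B)%E.
Proof. exact: (@le_outer_measure _ _ (wlength (@idfun R))^*%mu). Qed.

Lemma lebesgue_measure_bigcup_le (R : realType) (A : nat -> set R) :
  (lebesgue_measure (\bigcup_k A k) <=
   \sum_(0 <= k <oo) lebesgue_measure (A k))%E.
Proof.
exact: (@outer_measure_sigma_subadditive _ _ (wlength (@idfun R))^*%mu).
Qed.

Lemma cumulative_measure_itv (R : realType) (u : cumulative R R) (x y : R) :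
  x <= y -> lebesgue_stieltjes_measure u `]x, y] = (u y - u x)%:E.
Proof.
move=> xy; rewrite /lebesgue_stieltjes_measure /measure_extension.
by rewrite measurable_mu_extE/= ?wlength_itv_bnd//; exact: is_ocitv.
Qed.

(** A cover of [E] by intervals []x, y]] gives a cover of the image by the intervals [[u x, u y]],
    whose lengths are the weights in the outer measure of [u]. *)
Lemma le_lebesgue_image_cumulative (R : realType) (u : cumulative R R)
    (E : set R) :
  (lebesgue_measure (u @` E) <= lebesgue_stieltjes_measure u E)%E.
Proof.
apply/ereal_infP => _ [A [mA EA] <-].
have sub : u @` E `<=` \bigcup_k (u @` A k).
  by move=> _ [x /EA[k _ Akx] <-]; exists k => //; exists x.
apply: (le_trans (le_lebesgue_measureT sub)).
apply: (le_trans (lebesgue_measure_bigcup_le _)).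
apply: lee_nneseries => // k _.
have [[/= x y] _ <-] := mA k.
have [yx|xy] := leP y x.
  by rewrite set_itv_ge ?image_set0 ?measure0// bnd_simp -leNgt.
rewrite wlength_itv_bnd ?(ltW xy)//.
have sub' : u @` `]x, y] `<=` `[u x, u y].
  move=> _ [z /= + <-]; rewrite !in_itv/= => /andP[/ltW xz zy].
  by apply/andP; split; exact: cumulative_is_nondecreasing.
apply: (le_trans (le_lebesgue_measureT sub')).
rewrite lebesgue_measure_itv/= lte_fin; case: ifPn => //.
by rewrite lee_fin subr_ge0 cumulative_is_nondecreasing ?ltW.
Qed.

Lemma le_cumulative_lebesgue (R : realType) (u : cumulative R R) (E : set R) :
  (forall x y, x <= y -> u y - u x <= y - x) ->
  (lebesgue_stieltjes_measure u E <= lebesgue_measure E)%E.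
Proof.
move=> uL; apply/ereal_infP => _ [A [mA EA] <-].
apply: (@le_trans _ _ (\sum_(0 <= k <oo) wlength u (A k))%E).
  by apply: ereal_inf_lbound; exists A.
apply: lee_nneseries => [k _ _|k _]; first exact: wlength_ge0.
have [[/= x y] _ <-] := mA k.
have [yx|xy] := leP y x.
  by rewrite set_itv_ge ?wlength0// bnd_simp -leNgt.
by rewrite !wlength_itv_bnd ?(ltW xy)// lee_fin uL// ltW.
Qed.

(* The exceptional set consists of the non-Lebesgue points and of the zeros of
   the density of the Stieltjes measure; both are null for that measure. *)
Lemma lipschitz_cumulative_derive (R : realType) (u : cumulative R R) (x y : R) :
  (forall s t, s <= t -> u t - u s <= t - s) -> x < y ->
  exists2 E : set R, lebesgue_measure (u @` E) = 0 &
    forall z, x < z < y -> ~ E z -> exists2 l, 0 < l & is_derive z 1 u l.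
Proof.
move=> uL xy; pose nu : {measure set (measurableTypeR R) -> \bar R} :=
  lebesgue_stieltjes_measure u.
pose D : set (measurableTypeR R) := `]x, y]%classic.
have mD : measurable D by exact: measurable_itv.
have nuD : (nu D < +oo)%E by rewrite /nu/D/= cumulative_measure_itv ?(ltW xy)// ltry.
(* Restriction to []x, y]] makes the measure finite and the Lipschitz bound makes it absolutely
   continuous. Its density is the derivative of [u] at Lebesgue points. *)
pose nuf : {finite_measure set (measurableTypeR R) -> \bar R} := mfrestr mD nuD.
have dom : nuf `<< (@lebesgue_measure R).
  apply/null_content_dominatesP => A mA A0.
  apply/eqP; rewrite eq_le measure_ge0 andbT -A0.
  apply: le_trans (le_cumulative_lebesgue _ uL).
  by apply: le_measure; rewrite ?inE//; exact: measurableI.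
have [rho [rho0 rhofin irho nuE]] := radon_nikodym_sigma_finite dom.
pose f : R -> R := fun s => fine (rho s).
have fE : EFin \o f = rho by apply/funext => s; rewrite /= fineK.
have intf A : measurable A -> (@lebesgue_measure R).-integrable A (EFin \o f).
  by move=> mA; rewrite fE; apply: (integrableS measurableT).
have locf : locally_integrable setT f.
  have -> : f = f \_ setT by apply/funext => s; rewrite patchE in_setT.
  exact/integrable_locally/intf.
pose F t := \int[lebesgue_measure]_(s in [set` Interval (BRight x) (BRight t)]) f s.
have uF t : x <= t <= y -> u t - u x = F t.
  move=> /andP[xt ty]; rewrite /F /Rintegral -/(EFin \o f) fE -nuE//.
  rewrite [nuf _]/= /mfrestr/= /mrestr setIidl.
    by rewrite [nu _]/= cumulative_measure_itv.
  by move=> s; rewrite /D/= !in_itv/= => /andP[-> /le_trans]; exact.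
have [N [mN N0 NE]] := lebesgue_differentiation locf.
pose Z : set (measurableTypeR R) := rho @^-1` [set 0%E].
have mZ : measurable Z.
  rewrite -[Z]setTI; apply: (measurable_int _ irho) => //.
pose E : set (measurableTypeR R) := N `|` (Z `&` D).
exists E; last first.
  move=> z /andP[xz zy] Ez.
  have fz : lebesgue_pt f z.
    by apply: contrapT => fz; apply: Ez; left; exact: NE.
  have [||dF F'] := FTC1_lebesgue_pt (a := BRight x) zy _ _ fz.
    exact: intf.
    by rewrite lte_fin.
  exists (f z).
    rewrite lt_neqAle fine_ge0// andbT eq_sym; apply/eqP => f0.
    apply: Ez; right; split; last by rewrite /D/= in_itv/= xz ltW.
    by rewrite /Z/= -[rho z]fineK// -/(f z) f0.
  have : is_derive z 1 (F + cst (u x)) (f z).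
    rewrite -[f z]addr0; apply: is_deriveD.
    exact: (DeriveDef dF (etrans (esym (derive1E _ _)) F')).
  apply: near_eq_is_derive; near=> t.
  rewrite fctE /= -uF ?subrK//; apply/andP; split; apply: ltW.
    by near: t; exact: lt_nbhsr.
  by near: t; exact: lt_nbhsl.
apply/eqP; rewrite eq_le measure_ge0 andbT.
apply: (le_trans (le_lebesgue_image_cumulative _ _)).
have -> : lebesgue_stieltjes_measure u E = nu E by [].
apply: (le_trans (measureU2 _ _ _)) => //; first exact: measurableI.
rewrite -[0%E]adde0; apply: leeD.
  by rewrite -N0; exact: le_cumulative_lebesgue.
suff : (nuf Z <= 0)%E by [].
by rewrite nuE// (eq_integral (cst 0%E)) ?integral0// => s /set_mem.
Unshelve. all: by end_near. Qed.

(* The increasing function [x + h x] expands distances, so its generalized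
   inverse [u] is 1-Lipschitz, and [h] is derivable at [x] as soon as [u] has a
   positive derivative at [x + h x]. *)
Lemma nondecreasing_derivable_ae (R : realType) (h : R -> R) (c d : R) :
  {homo h : x y / x <= y} -> c < d ->
  exists2 E : set R, lebesgue_measure E = 0 &
    forall x, c < x < d -> ~ E x -> derivable h x 1.
Proof.
move=> hnd cd; pose H x := x + h x.
have Hlt x y : x < y -> H x < H y by move=> xy; rewrite ltr_leD// hnd// ltW.
have Hle x y : x <= y -> H x <= H y by move=> xy; rewrite lerD// hnd.
(* The point [c] is added so that [S y] is never empty and [u y] always lies in [[c, d]]. *)
pose S y := [set x | x = c \/ (c <= x <= d /\ H x <= y)].
pose u y := sup (S y).
have Sub y : ubound (S y) d by move=> x [->|[/andP[]]]//; exact: ltW.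
have Su y x : S y x -> x <= u y.
  by move=> Sx; apply: ub_le_sup => //; exists d.
have uS y z : (forall x, S y x -> x <= z) -> u y <= z.
  by move=> Sz; apply: ge_sup => //; exists c; left.
have uc y : c <= u y by apply: Su; left.
(* If a point [x] of [S t] exceeded [u s + (t - s)], then [x - (t - s)] would belong to [S s],
   because [H] decreases by at least [t - s] on the way. *)
have uL s t : s <= t -> u t - u s <= t - s.
  move=> st; rewrite lerBlDr; apply: uS => x [->|[/andP[cx xd] Hx]].
    by rewrite -[c]add0r lerD// subr_ge0.
  rewrite leNgt; apply/negP => ux.
  have {}ux : u s < x - (t - s) by lra.
  have := ux; rewrite ltNge => /negP; apply; apply: Su; right; split.
    by have := uc s; lra.
  have : h (x - (t - s)) <= h x by apply: hnd; lra.
  by move: Hx; rewrite /H; lra.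
have und : {homo u : s t / s <= t}.
  move=> s t st; apply: uS => x [->//|[xcd Hx]].
  by apply: Su; right; split => //; exact: le_trans st.
have ucont : continuous u.
  move=> s; apply/cvgrPdist_le => e e0; near=> t.
  have te : `|s - t| <= e by near: t; apply: cvgr_dist_le => //; exact: cvg_id.
  apply: le_trans te; have [st|/ltW ts] := leP s t.
    by rewrite ler0_norm ?ler0_norm ?subr_le0// ?und//; have := uL _ _ st; lra.
  by rewrite ger0_norm ?ger0_norm ?subr_ge0// ?und//; exact: uL.
have uH x : c <= x <= d -> u (H x) = x.
  move=> xcd; apply/eqP; rewrite eq_le; apply/andP; split; last first.
    by apply: Su; right.
  apply: uS => y [->|[_ Hyx]]; first by case/andP: xcd.
  by rewrite leNgt; apply/negP => /Hlt; rewrite ltNge Hyx.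
pose v : cumulative R R :=
  HB.pack u (isCumulative.Build R _ R u und (right_continuousW ucont)).
have [E E0 uE] := @lipschitz_cumulative_derive R v (H c) (H d) uL (Hlt _ _ cd).
exists (u @` E) => // x /andP[cx xd] Ex.
have xcd : c <= x <= d by rewrite !ltW.
have HxE : ~ E (H x) by move=> HxE; apply: Ex; exists (H x) => //; exact: uH.
have [|l l0 /is_derive1_epsP ul] := uE (H x) _ HxE; first by rewrite !Hlt.
suff : is_derive x 1 h (l^-1 - 1) by case.
apply/is_derive1_epsP => e e0.
(* The bound [l / 2] gives [l * |H y - H x| <= 2 * |y - x|]; the bound [e * l ^+ 2 / 2] then turns
   the error of [u] into an error [e * |y - x|] for [h]. *)
pose e' := Num.min (l / 2) (e * l ^+ 2 / 2).
have e'0 : 0 < e' by rewrite lt_min !divr_gt0// mulr_gt0// exprn_gt0.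
have e'l : e' <= l / 2 by rewrite ge_min lexx.
have e'e : e' <= e * l ^+ 2 / 2 by rewrite ge_min lexx orbT.
have [r r0 ur] := ul _ e'0; rewrite /= uH// in ur.
(* [u] moves away from [x] by a definite amount at distance [r / 2] from [H x]. As [u] is monotone,
   this forces [H y] to stay within [r] of [H x] when [y] is close to [x]. *)
have up : x + l * r / 4 <= u (H x + r / 2).
  have := ur (H x + r / 2); rewrite addrAC subrr add0r gtr0_norm; last by lra.
  have -> : (r / 2 < r) by lra.
  move=> /(_ isT); rewrite ler_norml => /andP[+ _].
  have : e' * (r / 2) <= l / 2 * (r / 2) by rewrite ler_wpM2r//; lra.
  by nra.
have un : u (H x - r / 2) <= x - l * r / 4.
  have := ur (H x - r / 2); rewrite addrAC subrr add0r normrN gtr0_norm; last by lra.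
  have -> : (r / 2 < r) by lra.
  move=> /(_ isT); rewrite ler_norml => /andP[_].
  have : e' * (r / 2) <= l / 2 * (r / 2) by rewrite ler_wpM2r//; lra.
  by nra.
have lr : 0 < l * r / 4 by rewrite divr_gt0// mulr_gt0.
pose r' := Num.min (l * r / 4) (Num.min (x - c) (d - x)).
exists r'; first by rewrite !lt_min lr !subr_gt0 cx xd.
move=> y; rewrite !lt_min ltr_norml => /andP[yr /andP[yc yd]].
have {}yc : c <= y by move: yc; rewrite ltr_norml; lra.
have {}yd : y <= d by move: yd; rewrite ltr_norml; lra.
have uy : u (H y) = y by rewrite uH// yc yd.
have Hyr : `|H y - H x| < r.
  rewrite ltr_norml; apply/andP; split; rewrite ltNge; apply/negP => Hy.
    by have := und (H y) (H x - r / 2); rewrite uy; lra.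
  by have := und (H x + r / 2) (H y); rewrite uy; lra.
have := ur _ Hyr; rewrite /= uy.
have -> : h y - h x = H y - H x - (y - x) by rewrite /H; lra.
set X := y - x; set Y := H y - H x => XY.
have -> : Y - X - (l^-1 - 1) * X = - (X - l * Y) / l by field; rewrite gt_eqF.
rewrite normrM normrN normfV (gtr0_norm l0) ler_pdivrMr//.
apply: (le_trans XY).
have YX : `|Y| * l <= 2 * `|X|.
  have : l * `|Y| <= `|X| + `|X - l * Y|.
    by have := ler_normB X (X - l * Y); rewrite subKr normrM (gtr0_norm l0).
  have : e' * `|Y| <= l / 2 * `|Y| by rewrite ler_wpM2r.
  by lra.
have : e' * `|Y| <= e * l ^+ 2 / 2 * `|Y| by rewrite ler_wpM2r.
have : e * l / 2 * (`|Y| * l) <= e * l / 2 * (2 * `|X|).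
  by rewrite ler_wpM2l// divr_ge0// mulr_ge0// ltW.
by lra.
Unshelve. all: by end_near. Qed.

(** * Uniform differentiability on large compact sets *)

(* By monotonicity the quotients at the scales [n.+1%:R^-1] control all scales. *)
Lemma nondecreasing_increment_bound (R : realType) (G : R -> R) (p M e : R)
    (N : nat) :
  {homo G : s t / s <= t} -> 0 < e -> 0 <= p <= M -> M + e <= e * N.+1%:R ->
  (forall n, (N <= n)%N -> `|n.+1%:R * G n.+1%:R^-1 - p| <= e) ->
  forall t, 0 < t < N.+1%:R^-1 -> `|G t - p * t| <= 2 * e * t.
Proof.
move=> Gnd e0 /andP[p0 pM] MN GN t /andP[t0 tN].
have t'0 : 0 <= t^-1 by rewrite invr_ge0 ltW.
(* [t] lies between [k.+1%:R^-1] and [k%:R^-1]. Replacing [k] by [k + 1] costs in the upper bound a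
   term [(p + e) * t], which [M + e <= e * k%:R] makes at most [e * k%:R * t]. *)
have := truncn_itv t'0; set k := Num.truncn _ => /andP[kt tk].
have Nk : (N.+1 <= k)%N.
  rewrite -ltnS -(ltr_nat R); apply: lt_trans tk.
  by rewrite -[X in X < _]invrK ltf_pV2 ?posrE// invr_gt0.
have k0 : (0 < k)%N by exact: leq_trans Nk.
have kt1 : k%:R * t <= 1 by rewrite -ler_pdivlMr// mul1r.
have tk1 : 1 < k.+1%:R * t by rewrite -ltr_pdivrMr// mul1r.
have kR : 0 < k%:R :> R by rewrite ltr0n.
have kR1 : k.+1%:R = k%:R + 1 :> R by rewrite -natr1.
have eN : M + e <= e * k%:R.
  by apply: (le_trans MN); rewrite ler_pM2l// ler_nat.
have Gk : `|k%:R * G k%:R^-1 - p| <= e.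
  by have := GN k.-1; rewrite prednK//; apply; rewrite -ltnS prednK.
have Gk1 := GN k (leq_trans (leqnSn _) Nk).
have Gtk : G t <= G k%:R^-1 by apply: Gnd; rewrite -[t]invrK lef_pV2 ?posrE// invr_gt0.
have Gtk1 : G k.+1%:R^-1 <= G t.
  by apply: Gnd; rewrite -[t]invrK lef_pV2 ?posrE ?invr_gt0 ?ltr0n// ltW.
rewrite ler_norml in Gk; rewrite ler_norml in Gk1.
rewrite kR1 in tk1 Gtk1 Gk1.
move: Gtk Gtk1 Gk Gk1; set A := G _; set B := G _; set C := G _.
move=> AB CA /andP[_ Bp] /andP[Cp _].
have up : k%:R * A <= p + e by have := ler_wpM2l (ltW kR) AB; lra.
have lo : p - e <= (k%:R + 1) * A.
  have kp : 0 <= k%:R + 1 :> R by lra.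
  by have := ler_wpM2l kp CA; lra.
have et : 0 < e * t by rewrite mulr_gt0.
have pt : 0 <= p * t by rewrite mulr_ge0// ltW.
have ekt : (M + e) * t <= e * k%:R * t by rewrite ler_wpM2r// ltW.
have pMt : p * t <= M * t by rewrite ler_wpM2r// ltW.
rewrite ler_norml; apply/andP; split.
  rewrite -(ler_pM2l (_ : 0 < k%:R + 1)); last by lra.
  have : p * (k%:R * t) <= p * 1 by rewrite ler_wpM2l.
  have : e * 1 <= e * ((k%:R + 1) * t) by apply: ler_wpM2l; lra.
  by lra.
rewrite -(ler_pM2l kR).
have : (p + e) * 1 <= (p + e) * ((k%:R + 1) * t) by apply: ler_wpM2l; lra.
by lra.
Qed.

Lemma uniform_cvg_norm (R : realType) (A : set R) (f : nat -> R -> R) (g : R -> R) :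
  {uniform A, f @ \oo --> g} -> forall e, 0 < e ->
  exists N, forall n, (N <= n)%N -> forall x, A x -> `|f n x - g x| <= e.
Proof.
move=> fg e e0.
have := fg [set g' | forall x, A x -> `|g' x - g x| <= e].
move=> [|N _ NA]; last by exists N => n /NA.
apply/uniform_nbhs; exists [set xy | ball xy.1 e xy.2]; split.
  exact: entourage_ball (PosNum e0).
by move=> g' g'g x Ax; have := g'g _ Ax; rewrite /ball/= distrC => /ltW.
Qed.

Lemma lebesgue_measureU_leT (R : realType) (A B : set R) :
  (lebesgue_measure (A `|` B) <= lebesgue_measure A + lebesgue_measure B)%E.
Proof. exact: (@outer_measureU2 _ _ (wlength (@idfun R))^*%mu). Qed.

Lemma nondecreasing_is_derive_ge0 (R : realType) (h : R -> R) (x l : R) :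
  {homo h : x y / x <= y} -> is_derive x 1 h l -> 0 <= l.
Proof.
move=> hnd /is_derive1_epsP hl; rewrite leNgt; apply/negP => l0.
have e0 : 0 < - l / 2 by lra.
have [r r0 hr] := hl _ e0.
have xr : x + r / 2 - x = r / 2 by rewrite addrAC subrr add0r.
have := hr (x + r / 2); rewrite xr gtr0_norm; last by lra.
have -> : r / 2 < r by lra.
move=> /(_ isT); rewrite ler_norml => /andP[_].
have : h x <= h (x + r / 2) by apply: hnd; lra.
have : 0 < - l * r by rewrite mulr_gt0 ?oppr_gt0.
by lra.
Qed.

(** Egorov's theorem applied to a sequence of scales; the sign [s] treats right and left quotients
    at once. Measurability of the quotients comes from the monotonicity of [h]. *)
Lemma difference_quotient_almost_uniform (R : realType) (h : R -> R)
    (A : set R) (s e : R) :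
  {homo h : x y / x <= y} -> `|s| = 1 -> measurable A ->
  (lebesgue_measure A < +oo)%E -> (forall x, A x -> derivable h x 1) -> 0 < e ->
  exists B, [/\ measurable B, (lebesgue_measure B < e%:E)%E &
    forall eta, 0 < eta -> exists N, forall n, (N <= n)%N ->
      forall x, (A `\` B) x ->
      `|n.+1%:R * (s * (h (x + s * n.+1%:R^-1) - h x)) - h^`()%classic x| <= eta].
Proof.
move=> hnd s1 mA Afin Ad e0.
pose q n x := n.+1%:R * (s * (h (x + s * n.+1%:R^-1) - h x)).
have s2 : s * s = 1 by rewrite -expr2 -real_normK ?num_real// s1 expr1n.
have [|x Ax|B [mB Be qB]] :=
    @pointwise_almost_uniform _ _ _ (@lebesgue_measure R) q (h^`()%classic) A e
      _ mA Afin _ e0.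
- move=> n; apply: measurable_funM => //; apply: measurable_funM => //.
  apply: measurable_funB; apply: nondecreasing_measurable => // x y xy.
  by apply: hnd; rewrite lerD2r.
- apply/cvgrPdist_le => eta eta0.
  have /derivableP := Ad _ Ax; rewrite -derive1E => /is_derive1_epsP/(_ _ eta0).
  move=> [r r0 hr].
  near=> n.
  have nr : n.+1%:R^-1 < r by near: n; exact: (near_infty_natSinv_lt (PosNum r0)).
  have n0 : 0 < n.+1%:R :> R by [].
  have xs : x + s * n.+1%:R^-1 - x = s * n.+1%:R^-1 by rewrite addrAC subrr add0r.
  have := hr (x + s * n.+1%:R^-1); rewrite xs [`|s * _|]normrM s1 mul1r.
  rewrite gtr0_norm ?invr_gt0// => /(_ nr); rewrite ler_pdivlMr// => hle.
  rewrite distrC; apply: le_trans hle.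
  rewrite /q; set D := h _ - h x; set l := h^`()%classic x.
  have -> : n.+1%:R * (s * D) - l = s * ((D - l * (s * n.+1%:R^-1)) * n.+1%:R).
    have -> : s * ((D - l * (s * n.+1%:R^-1)) * n.+1%:R) =
      n.+1%:R * (s * D) - (s * s) * l * (n.+1%:R^-1 * n.+1%:R) by ring.
    by rewrite s2 mul1r mulVf ?mulr1// gt_eqF.
  by rewrite 2!normrM s1 mul1r (gtr0_norm n0).
- exists B; split => // eta eta0; exact: uniform_cvg_norm.
Unshelve. all: by end_near. Qed.

(** Right quotients, left quotients and inner regularity cost measure [e / 3] each. Passing from the
    scales [n.+1%:R^-1] to all small increments needs one bound for the derivatives on [K], which
    uniform convergence provides. *)
Lemma nondecreasing_uniform_derivable (R : realType) (h : R -> R) (c d e : R) :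
  {homo h : x y / x <= y} -> c < d -> 0 < e ->
  exists K : set R, [/\ compact K, K `<=` `]c, d[,
    (lebesgue_measure (`]c, d[ `\` K) < e%:E)%E,
    forall x, K x -> derivable h x 1 &
    forall eta, 0 < eta -> exists2 r, 0 < r & forall x, K x ->
      forall y, `|y - x| < r ->
        `|h y - h x - h^`()%classic x * (y - x)| <= eta * `|y - x|].
Proof.
move=> hnd cd e0; have e30 : 0 < e / 3 by lra.
have [E /negligible_outer_measure[N [mN N0 EN]] dE] :=
  nondecreasing_derivable_ae hnd cd.
pose I : set (measurableTypeR R) := `]c, d[%classic.
have mI : measurable I by exact: measurable_itv.
have mA : measurable (I `\` N) by exact: measurableD.
have Ifin : (lebesgue_measure I < +oo)%E.
  by rewrite lebesgue_measure_itv/=; case: ifPn => // _; rewrite -EFinB ltry.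
have Afin : (lebesgue_measure (I `\` N) < +oo)%E.
  by apply: le_lt_trans Ifin; apply: le_lebesgue_measureT => x [].
have Ad x : (I `\` N) x -> derivable h x 1.
  move=> [Ix Nx]; apply: dE; last by move/EN.
  by move: Ix; rewrite /I/= in_itv.
have [B1 [mB1 B1e hB1]] := difference_quotient_almost_uniform hnd (normr1 R)
  mA Afin Ad e30.
have [B2 [mB2 B2e hB2]] := difference_quotient_almost_uniform hnd (normrN1 R)
  mA Afin Ad e30.
pose B := B1 `|` B2.
have mB : measurable B by exact: measurableU.
have mAB : measurable ((I `\` N) `\` B) by exact: measurableD.
have ABfin : (lebesgue_measure ((I `\` N) `\` B) < +oo)%E.
  by apply: le_lt_trans Afin; apply: le_lebesgue_measureT => x [].
have [K [cK KAB KE]] := lebesgue_regularity_inner mAB ABfin e30.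
have KA x : K x -> (I `\` N) x by move=> /KAB[].
have hK1 eta : 0 < eta -> exists M, forall n, (M <= n)%N -> forall x, K x ->
    `|n.+1%:R * (h (x + n.+1%:R^-1) - h x) - h^`()%classic x| <= eta.
  move=> /hB1[M hM]; exists M => n /hM + x /KAB[Ax Bx] => /(_ x).
  by rewrite !mul1r; apply; split => // B1x; apply: Bx; left.
have hK2 eta : 0 < eta -> exists M, forall n, (M <= n)%N -> forall x, K x ->
    `|n.+1%:R * (h x - h (x - n.+1%:R^-1)) - h^`()%classic x| <= eta.
  move=> /hB2[M hM]; exists M => n /hM + x /KAB[Ax Bx] => /(_ x).
  by rewrite !mulN1r opprB; apply; split => // B2x; apply: Bx; right.
exists K; split => //.
- by move=> x /KA[].
- have mK : measurable K by exact: compact_measurable.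
  have sub : I `\` K `<=` (N `|` B1) `|` (B2 `|` (((I `\` N) `\` B) `\` K)).
    move=> x [Ix Kx]; have [Nx|Nx] := pselect (N x); first by left; left.
    have [B1x|B1x] := pselect (B1 x); first by left; right.
    have [B2x|B2x] := pselect (B2 x); first by right; left.
    by right; right; split => //; split => // -[].
  apply: (le_lt_trans (le_lebesgue_measureT sub)).
  have h1 : (lebesgue_measure (N `|` B1) < (e / 3)%:E)%E.
    by apply: (le_lt_trans (lebesgue_measureU_leT _ _)); rewrite N0 add0e.
  have h2 : (lebesgue_measure (B2 `|` (((I `\` N) `\` B) `\` K)) <
      (e / 3 + e / 3)%:E)%E.
    by apply: (le_lt_trans (lebesgue_measureU_leT _ _)); rewrite EFinD lteD.
  have -> : e = e / 3 + (e / 3 + e / 3) by lra.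
  apply: (le_lt_trans (lebesgue_measureU_leT _ _)).
  by rewrite EFinD lteD.
- by move=> x /KA; exact: Ad.
move=> eta eta0.
(* At the scale [M1.+1%:R^-1] the quotient is within [1] of the derivative, uniformly on [K], and it
   is bounded since [x] stays in []c, d[] and the scale is at most [1]. *)
have [M1 hM1] := hK1 _ ltr01.
pose M := M1.+1%:R * (h (d + 1) - h c) + 1.
have Kp x : K x -> 0 <= h^`()%classic x <= M.
  move=> Kx; have /KA[] := Kx; rewrite /I/= in_itv/= => /andP[cx xd] _.
  have dhx := Ad _ (KA _ Kx).
  apply/andP; split.
    apply: (nondecreasing_is_derive_ge0 hnd (x := x)).
    by rewrite derive1E; apply/derivableP/Ad/KA.
  have := hM1 _ (leqnn _) _ Kx.
  rewrite ler_norml => /andP[+ _].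
  have : h (x + M1.+1%:R^-1) - h x <= h (d + 1) - h c.
    apply: lerB; apply: hnd; last exact: ltW.
    by apply: lerD; [exact: ltW|rewrite invf_le1// ler1n].
  by move=> /(ler_wpM2l (ler0n R M1.+1)); rewrite /M; lra.
pose e' := eta / 2; have e'0 : 0 < e' by rewrite /e'; lra.
have [N1 hN1] := hK1 _ e'0; have [N2 hN2] := hK2 _ e'0.
pose N3 := Num.truncn ((M + e') / e').
pose n := maxn (maxn N1 N2) N3.
have nN1 : (N1 <= n)%N by rewrite !leq_max leqnn.
have nN2 : (N2 <= n)%N by rewrite !leq_max leqnn orbT.
have MN : M + e' <= e' * n.+1%:R.
  rewrite mulrC -ler_pdivrMr//; apply: le_trans (ltW (truncnS_gt _)) _.
  by rewrite ler_nat ltnS leq_max leqnn orbT.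
exists n.+1%:R^-1 => // x Kx y yx.
have xp := Kp _ Kx.
have etaE t : 2 * e' * t = eta * t by rewrite /e'; lra.
have [yx0|xy|->] := ltgtP y x; last by rewrite !subrr mulr0 subrr normr0 mulr0.
- have := @nondecreasing_increment_bound R (fun t => h x - h (x - t)) _ M e' n
    _ e'0 xp MN _ (x - y).
  have e1 : `|y - x| = x - y by rewrite distrC gtr0_norm ?subr_gt0.
  rewrite e1 in yx *; rewrite etaE subKr.
  have -> : h y - h x - h^`()%classic x * (y - x) =
    - (h x - h y - h^`()%classic x * (x - y)) by ring.
  rewrite normrN; apply.
  + by move=> s t st; rewrite lerB// hnd// lerB.
  + by move=> k nk; apply: hN2 => //; exact: leq_trans nk.
  + by rewrite subr_gt0 yx0.
- have := @nondecreasing_increment_bound R (fun t => h (x + t) - h x) _ M e' n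
    _ e'0 xp MN _ (y - x).
  have e1 : `|y - x| = y - x by rewrite gtr0_norm ?subr_gt0.
  rewrite e1 in yx *; rewrite etaE subrKC; apply.
  + by move=> s t st; rewrite lerB// hnd// lerD.
  + by move=> k nk; apply: hN1 => //; exact: leq_trans nk.
  + by rewrite subr_gt0 xy.
Qed.

(** * Splines *)

Section ramp.
Context {R : realType}.
Implicit Types (a c d x y t : R) (f g : R -> R).

Lemma is_derive1_add f g x l m :
  is_derive x 1 f l -> is_derive x 1 g m ->
  is_derive x 1 (fun y => f y + g y) (l + m).
Proof. exact: is_deriveD. Qed.

Lemma is_derive1_scale f x l a :
  is_derive x 1 f l -> is_derive x 1 (fun y => a * f y) (a * l).
Proof. exact: is_deriveZ. Qed.

(** A second order remainder determines the derivative; in this form the kink of the positive part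
    needs no separate limit. *)
Lemma is_derive1_quadratic f x l C :
  (forall y, `|y - x| < 1 -> `|f y - f x - l * (y - x)| <= C * (y - x) ^+ 2) ->
  is_derive x 1 f l.
Proof.
move=> fC; apply/is_derive1_epsP => e e0.
pose D := `|C| + 1; have D0 : 0 < D by rewrite ltr_wpDl.
exists (Num.min 1 (e / D)); first by rewrite lt_min ltr01 divr_gt0.
move=> y; rewrite lt_min => /andP[y1 ye]; apply: (le_trans (fC _ y1)).
rewrite -real_normK ?num_real// expr2 mulrA ler_wpM2r//.
have CD : C <= D by rewrite (le_trans (ler_norm _))// lerDl.
apply: (@le_trans _ _ (D * `|y - x|)); first by rewrite ler_wpM2r.
by rewrite mulrC -ler_pdivlMr// ltW.
Qed.

Lemma is_derive1_affine a b x : is_derive x 1 (fun y => a * (y - b)) a.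
Proof.
apply: (@is_derive1_quadratic _ _ _ 0) => y _.
by rewrite -mulrBr opprB addrA subrK subrr normr0 mul0r.
Qed.

Lemma is_derive1_sqr b x : is_derive x 1 (fun y => (y - b) ^+ 2 / 2) (x - b).
Proof.
apply: (@is_derive1_quadratic _ _ _ 1) => y _; rewrite mul1r ler_norml.
by have ? := sqr_ge0 (y - x); apply/andP; split; lra.
Qed.

Definition pospart x := Num.max x 0.

Lemma pospartP x : (x <= 0 /\ pospart x = 0) \/ (0 <= x /\ pospart x = x).
Proof.
have [x0|x0] := leP x 0; [left|right]; rewrite /pospart.
  by rewrite max_r.
by rewrite max_l// ltW.
Qed.

Lemma is_derive1_pospart2 a x :
  is_derive x 1 (fun y => pospart (y - a) ^+ 2) (2 * pospart (x - a)).
Proof.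
apply: (@is_derive1_quadratic _ _ _ 1) => y _; rewrite mul1r ler_norml.
have -> : y - x = (y - a) - (x - a) by ring.
set s := x - a; set t := y - a.
have s2 := sqr_ge0 s; have t2 := sqr_ge0 t; have st2 := sqr_ge0 (t - s).
have [[s0 ->]|[s0 ->]] := pospartP s; have [[t0 ->]|[t0 ->]] := pospartP t;
  apply/andP; split; rewrite ?expr0n/=; try lra.
- by have : 0 <= - s * t; [rewrite mulr_ge0//; lra|lra].
- by have : 0 <= s * - t; [rewrite mulr_ge0//; lra|lra].
Qed.

Lemma is_derive1_pospart3 a x :
  is_derive x 1 (fun y => pospart (y - a) ^+ 3) (3 * pospart (x - a) ^+ 2).
Proof.
(* With both arguments [s] and [t] nonnegative the remainder is [(t - s) ^+ 2 * (t + 2 * s)], where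
   [|t - s| < 1]. The additive [3] covers arguments of opposite signs. *)
apply: (@is_derive1_quadratic _ _ _ (3 * `|x - a| + 3)) => y yx.
have {}yx : `|(y - a) - (x - a)| < 1 by have -> : y - a - (x - a) = y - x by ring.
have -> : y - x = (y - a) - (x - a) by ring.
move: yx; set s := x - a; set t := y - a.
rewrite ltr_norml => /andP[ts1 ts2].
have B : (`|s| + 2 * `|s| + 3) = 3 * `|s| + 3 by ring.
have d0 : 0 <= (t - s) ^+ 2 by exact: sqr_ge0.
have [[s0 ->]|[s0 ->]] := pospartP s; [rewrite (ler0_norm s0)|rewrite (ger0_norm s0)];
  have [[t0 ->]|[t0 ->]] := pospartP t.
- have -> : 0 ^+ 3 - 0 ^+ 3 - 3 * 0 ^+ 2 * (t - s) = 0 :> R by ring.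
  by rewrite normr0 mulr_ge0//; lra.
- have -> : t ^+ 3 - 0 ^+ 3 - 3 * 0 ^+ 2 * (t - s) = t ^+ 3 by ring.
  rewrite ger0_norm ?exprn_ge0//.
  rewrite (exprSr t 2).
  have : t ^+ 2 * t <= (t - s) ^+ 2 * t by rewrite ler_wpM2r//; nra.
  have : (t - s) ^+ 2 * t <= (t - s) ^+ 2 * 3 by rewrite ler_wpM2l//; lra.
  have : 0 <= (t - s) ^+ 2 * - s by rewrite mulr_ge0//; lra.
  by lra.
- have -> : 0 ^+ 3 - s ^+ 3 - 3 * s ^+ 2 * (t - s) = s ^+ 2 * (2 * s - 3 * t) by ring.
  rewrite ger0_norm; last by rewrite mulr_ge0 ?sqr_ge0//; lra.
  have : s ^+ 2 * (2 * s - 3 * t) <= (t - s) ^+ 2 * (2 * s - 3 * t).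
    by rewrite ler_wpM2r//; [lra|nra].
  have : (t - s) ^+ 2 * (2 * s - 3 * t) <= (t - s) ^+ 2 * (3 * s + 3).
    by rewrite ler_wpM2l//; lra.
  by lra.
- have -> : t ^+ 3 - s ^+ 3 - 3 * s ^+ 2 * (t - s) = (t - s) ^+ 2 * (t + 2 * s).
    by ring.
  rewrite ger0_norm; last by rewrite mulr_ge0//; lra.
  by rewrite mulrC ler_wpM2r//; lra.
Qed.

Variables (a t : R).
Hypothesis t0 : 0 < t.

(** Truncated powers: [ramp] rises linearly from 0 to 1 on [[a, a + t]], and [ramp1], [ramp2] are
    its iterated primitives that vanish to the left of [a]. *)
Definition ramp x := (pospart (x - a) - pospart (x - (a + t))) / t.
Definition ramp1 x := (pospart (x - a) ^+ 2 - pospart (x - (a + t)) ^+ 2) / (2 * t).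
Definition ramp2 x := (pospart (x - a) ^+ 3 - pospart (x - (a + t)) ^+ 3) / (6 * t).

Lemma is_derive1_ramp1 x : is_derive x 1 ramp1 (ramp x).
Proof.
have tN0 : t != 0 by rewrite gt_eqF.
have -> : ramp1 = fun x => (2 * t)^-1 * pospart (x - a) ^+ 2 +
    - (2 * t)^-1 * pospart (x - (a + t)) ^+ 2.
  by apply/funext => y; rewrite /ramp1; field.
apply: is_derive_eq.
  by apply: is_derive1_add; apply: is_derive1_scale; exact: is_derive1_pospart2.
by rewrite /ramp; field.
Qed.

Lemma is_derive1_ramp2 x : is_derive x 1 ramp2 (ramp1 x).
Proof.
have tN0 : t != 0 by rewrite gt_eqF.
have -> : ramp2 = fun x => (6 * t)^-1 * pospart (x - a) ^+ 3 +
    - (6 * t)^-1 * pospart (x - (a + t)) ^+ 3.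
  by apply/funext => y; rewrite /ramp2; field.
apply: is_derive_eq.
  by apply: is_derive1_add; apply: is_derive1_scale; exact: is_derive1_pospart3.
by rewrite /ramp1; field.
Qed.

Lemma continuous_ramp : continuous ramp.
Proof.
have cp b : continuous (fun x => pospart (x - b)).
  move=> x; apply/cvgrPdist_le => e e0; near=> y.
  have xy : `|x - y| <= e by near: y; apply: cvgr_dist_le => //; exact: cvg_id.
  apply: le_trans xy.
  have -> : x - y = (x - b) - (y - b) by ring.
  have [[? ->]|[? ->]] := pospartP (x - b);
  have [[? ->]|[? ->]] := pospartP (y - b) => //; rewrite ?subrr ?normr0//.
  - by rewrite sub0r normrN ger0_norm// ler0_norm; lra.
  - by rewrite subr0 ger0_norm// ger0_norm; lra.
by move=> x; apply: cvgM; [apply: cvgB; exact: cp|exact: cvg_cst].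
Unshelve. all: by end_near. Qed.

Lemma ramp_le x : x <= a -> [/\ ramp x = 0, ramp1 x = 0 & ramp2 x = 0].
Proof.
have t00 := t0; move=> xa.
by rewrite /ramp /ramp1 /ramp2 /pospart !max_r ?expr0n/= ?subrr ?mul0r//; lra.
Qed.

Lemma ramp_ge x : a + t <= x ->
  [/\ ramp x = 1, ramp1 x = x - a - t / 2 &
      ramp2 x = (x - a) ^+ 2 / 2 - (x - a) * t / 2 + t ^+ 2 / 6].
Proof.
have tN0 : t != 0 by rewrite gt_eqF.
have t00 := t0; move=> xa.
by rewrite /ramp /ramp1 /ramp2 /pospart !max_l; [split; field|lra..].
Qed.

Lemma ramp_itv x : 0 <= ramp x <= 1.
Proof.
rewrite /ramp; apply/andP; split;
  [apply: divr_ge0; last exact: ltW|rewrite ler_pdivrMr//];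
 have t00 := t0;
 have [[? ->]|[? ->]] := pospartP (x - a);
 have [[? ->]|[? ->]] := pospartP (x - (a + t)); lra.
Qed.

End ramp.

(** A weight is carried together with its two primitives, so that linear combinations of weights
    transport their integrals. *)
Definition C2_triple (R : realType) (G k w : R -> R) :=
  [/\ forall x : R, is_derive x 1 G (k x), forall x : R, is_derive x 1 k (w x) &
      continuous w].

Lemma C2_triple_lin (R : realType) (G k w G' k' w' : R -> R) (a b : R) :
  C2_triple G k w -> C2_triple G' k' w' ->
  C2_triple (fun x => a * G x + b * G' x) (fun x => a * k x + b * k' x)
    (fun x => a * w x + b * w' x).
Proof.
move=> [Gk kw cw] [Gk' kw' cw']; split=> [x|x|x].
- by apply: is_derive1_add; exact: is_derive1_scale.
- by apply: is_derive1_add; exact: is_derive1_scale.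
- by apply: cvgD; apply: cvgM; [exact: cvg_cst|exact: cw|exact: cvg_cst|exact: cw'].
Qed.

Lemma C2_triple_quadratic (R : realType) (c f0 h0 m : R) :
  C2_triple (fun x => f0 + h0 * (x - c) + m * ((x - c) ^+ 2 / 2))
    (fun x => h0 + m * (x - c)) (fun=> m).
Proof.
split=> [x|x|x]; last exact: cvg_cst.
- by apply: is_derive_eq; rewrite /GRing.scale/=; field.
- by apply: is_derive_eq; rewrite /GRing.scale/=; ring.
Qed.

(* The weight [w] drops from [al] to [0], stays there up to a point near
   [d - th], then stays at [1] up to the vicinity of [d], where it moves to
   [be]; the jump is placed so that the integral of [w] is exactly [th]. *)
Lemma step_spline (R : realType) (c d al be th e : R) :
  c < d -> 0 <= al <= 1 -> 0 <= be <= 1 -> 0 < th < d - c -> 0 < e ->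
  exists G k w : R -> R, [/\ C2_triple G k w,
    forall x, c <= x <= d -> 0 <= w x <= 1,
    [/\ G c = 0, k c = 0 & w c = al],
    k d = th /\ w d = be & `|G d - th ^+ 2 / 2| <= e].
Proof.
move=> cd /andP[al0 al1] /andP[be0 be1] /andP[th0 thL] e0.
pose L := d - c; have L0 : 0 < L by rewrite subr_gt0.
(* The first two bounds keep the break points in the order [c + t <= s], [s + t <= d - t]; the third
   keeps the effect of the smoothing on [G d] below [e]. *)
pose t := Num.min ((L - th) / 2) (Num.min (th / 2) (e / (4 * L))).
have t0 : 0 < t by rewrite !lt_min !divr_gt0// ?mulr_gt0// subr_gt0.
have tL : t <= (L - th) / 2 by rewrite ge_min lexx.
have tth : t <= th / 2 by rewrite !ge_min lexx orbT.
have te : t <= e / (4 * L) by rewrite !ge_min lexx !orbT.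
(* The surplus of [S] over [th] is the area lost to the ramps: [t / 2] at the jump and
   [(1 - be) * t / 2] at [d], minus [al * t / 2] gained at [c]. *)
pose S := th + t * (1 - (al + be) / 2).
have S1 : th <= S by rewrite lerDl mulr_ge0//; [exact: ltW|lra].
have S2 : S <= th + t by rewrite lerD2l ler_piMr//; [exact: ltW|lra].
pose s := d - S.
have cs : c + t <= s by rewrite /s; rewrite /L in tL; lra.
have sd : s + t <= d - t by rewrite /s; lra.
have cub : C2_triple (fun x => al * ((x - c) ^+ 2 / 2)) (fun x => al * (x - c)) (fun=> al).
  split=> [x|x|x]; last exact: cvg_cst.
    by apply: is_derive1_scale; exact: is_derive1_sqr.
  exact: is_derive1_affine.
have rt a : C2_triple (ramp2 a t) (ramp1 a t) (ramp a t).
  by split; [exact: is_derive1_ramp2|exact: is_derive1_ramp1|exact: continuous_ramp].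
have tr := C2_triple_lin 1 1
  (C2_triple_lin 1 (- al) cub (rt c))
  (C2_triple_lin 1 (be - 1) (rt s) (rt (d - t))).
eexists; eexists; eexists; split; first exact: tr.
- move=> x /andP[cx xd] /=.
  have /andP[r0 r1] := ramp_itv c t0 x.
  have /andP[r0' r1'] := ramp_itv s t0 x.
  have /andP[r0'' r1''] := ramp_itv (d - t) t0 x.
  have [xs|/ltW sx] := leP x s.
    have [-> _ _] := ramp_le t0 xs.
    have [|-> _ _] := ramp_le t0 (_ : x <= d - t); first by lra.
    by apply/andP; split; nra.
  have [|-> _ _] := ramp_ge t0 (_ : c + t <= x); first by lra.
  have [xt|/ltW tx] := leP x (d - t).
    by have [-> _ _] := ramp_le t0 xt; lra.
  have [|-> _ _] := ramp_ge t0 (_ : s + t <= x); first by lra.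
  by apply/andP; split; nra.
- have [-> -> ->] := ramp_le t0 (lexx c).
  have [|-> -> ->] := ramp_le t0 (_ : c <= s); first by lra.
  have [|-> -> ->] := ramp_le t0 (_ : c <= d - t); first by lra.
  by rewrite subrr; split; field.
- have [|-> -> _] := ramp_ge t0 (_ : c + t <= d); first by lra.
  have [|-> -> _] := ramp_ge t0 (_ : s + t <= d); first by lra.
  have [|-> -> _] := ramp_ge t0 (_ : d - t + t <= d); first by rewrite subrK.
  by split; [rewrite /s /S; field|ring].
- have [|_ _ ->] := ramp_ge t0 (_ : c + t <= d); first by lra.
  have [|_ _ ->] := ramp_ge t0 (_ : s + t <= d); first by lra.
  have [|_ _ ->] := ramp_ge t0 (_ : d - t + t <= d); first by rewrite subrK.
  have -> : d - s = S by rewrite /s; ring.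
  have -> : d - (d - t) = t by ring.
  rewrite -/L.
  have te4 : 4 * (L * t) <= e by move: te; rewrite ler_pdivlMr ?mulr_gt0//; lra.
  have tt : t * t <= L * t by rewrite ler_wpM2r//; [exact: ltW|rewrite /L in tL *; lra].
  have tt0 : 0 <= t * t by rewrite mulr_ge0// ltW.
  have Lt0 : 0 < L * t by rewrite mulr_gt0.
  have St : 0 <= S * t <= L * t.
    by rewrite mulr_ge0 ?ler_wpM2r//; try exact: ltW; lra.
  have SS : 0 <= (S - th) * (S + th) <= t * (2 * L).
    have S0 : 0 <= S - th by lra.
    rewrite mulr_ge0//=; last by lra.
    by apply: ler_pM => //; lra.
  have aLt : 0 <= al * (L * t) <= L * t by rewrite mulr_ge0 ?ler_piMl// ltW.
  have att : 0 <= al * (t * t) <= t * t by rewrite mulr_ge0 ?ler_piMl.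
  have btt : 0 <= be * (t * t) <= t * t by rewrite mulr_ge0 ?ler_piMl.
  by rewrite ler_norml; apply/andP; split; lra.
Qed.

(* The two step splines, with the jump from [m] to [M] and from [M] to [m], have
   values at [d] on either side of [f1]; a convex combination hits [f1]. *)
Lemma C2_interpolation (R : realType) (c d m M f0 h0 p f1 h1 q : R) :
  c < d -> m < M -> m <= p <= M -> m <= q <= M ->
  let L := d - c in let th := (h1 - h0 - m * L) / (M - m) in
  m * L < h1 - h0 < M * L ->
  m * L ^+ 2 / 2 + (M - m) * th ^+ 2 / 2 < f1 - f0 - h0 * L ->
  f1 - f0 - h0 * L < M * L ^+ 2 / 2 - (M - m) * (L - th) ^+ 2 / 2 ->
  exists G k w : R -> R, [/\ C2_triple G k w,
    forall x, c <= x <= d -> m <= w x <= M,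
    [/\ G c = f0, k c = h0 & w c = p] &
    [/\ G d = f1, k d = h1 & w d = q]].
Proof.
move=> cd mM /andP[mp pM] /andP[mq qM] L th /andP[mA AM] Tlo Thi.
set T := f1 - f0 - h0 * L in Tlo Thi.
pose s := M - m; have s0 : 0 < s by rewrite subr_gt0.
have sN0 : s != 0 by rewrite gt_eqF.
have MmN0 : M - m != 0 by [].
have norm01 x : m <= x <= M -> 0 <= (x - m) / s <= 1 /\ 0 <= (M - x) / s <= 1.
  move=> /andP[mx xM].
  by split; apply/andP; split; rewrite ?ler_pdivrMr//;
    try apply: divr_ge0; rewrite /s; lra.
have sth : s * th = h1 - h0 - m * L by rewrite /th mulrC divfK.
have th0 : 0 < th < L.
  apply/andP; split; first by rewrite -(pmulr_rgt0 _ s0) sth; lra.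
  by rewrite -(ltr_pM2l s0) sth /s; lra.
have th0' : 0 < L - th < L by lra.
have [al01 al01'] : _ := norm01 p (introT andP (conj mp pM)).
have [be01 be01'] : _ := norm01 q (introT andP (conj mq qM)).
(* Half of the slack in each strict hypothesis, rescaled by [s]: the smoothed splines still end
   strictly on their side of [f1]. *)
pose e1 := (T - (m * L ^+ 2 / 2 + (M - m) * th ^+ 2 / 2)) / s / 2.
pose e2 := (M * L ^+ 2 / 2 - (M - m) * (L - th) ^+ 2 / 2 - T) / s / 2.
have e10 : 0 < e1 by rewrite !divr_gt0// subr_gt0.
have e20 : 0 < e2 by rewrite !divr_gt0// subr_gt0.
have [G1 [k1 [w1 [C1 b1 [G1c k1c w1c] [k1d w1d] G1d]]]] :=
  step_spline cd al01 be01 th0 e10.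
have [G2 [k2 [w2 [C2 b2 [G2c k2c w2c] [k2d w2d] G2d]]]] :=
  step_spline cd al01' be01' th0' e20.
(* These are the values at [d] of the functions with second derivatives [m + s * w1] and
   [M - s * w2]. *)
pose g1 := f0 + h0 * L + m * (L ^+ 2 / 2) + s * G1 d.
pose g2 := f0 + h0 * L + M * (L ^+ 2 / 2) + - s * G2 d.
have g1f : g1 < f1.
  have : s * (G1 d - th ^+ 2 / 2) <= s * e1.
    by rewrite ler_pM2l// (le_trans (ler_norm _)).
  have -> : s * e1 = (T - (m * L ^+ 2 / 2 + (M - m) * th ^+ 2 / 2)) / 2.
    by rewrite /e1; field.
  by rewrite /g1 /s /T in Tlo *; lra.
have fg2 : f1 < g2.
  have : s * (G2 d - (L - th) ^+ 2 / 2) <= s * e2.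
    by rewrite ler_pM2l// (le_trans (ler_norm _)).
  have -> : s * e2 = (M * L ^+ 2 / 2 - (M - m) * (L - th) ^+ 2 / 2 - T) / 2.
    by rewrite /e2; field.
  by rewrite /g2 /s /T in Thi *; lra.
have g12 : 0 < g2 - g1 by lra.
pose t := (g2 - f1) / (g2 - g1).
have t01 : 0 <= t <= 1.
  by clear -g1f fg2 g12; rewrite ler_pdivrMr//; apply/andP; split;
    [apply: divr_ge0|]; lra.
have tf : t * g1 + (1 - t) * g2 = f1 by rewrite /t; field; rewrite gt_eqF.
pose Q := C2_triple_quadratic c f0 h0.
have tr := C2_triple_lin t (1 - t)
  (C2_triple_lin 1 s (Q m) C1) (C2_triple_lin 1 (- s) (Q M) C2).
eexists; eexists; eexists; split; first exact: tr.
- move=> x xcd; have /andP[w10 w11] := b1 _ xcd; have /andP[w20 w21] := b2 _ xcd.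
  have sM : m + s = M by rewrite /s addrC subrK.
  have sw1 : 0 <= s * w1 x <= s by rewrite mulr_ge0 ?ler_piMr// ltW.
  have sw2 : 0 <= s * w2 x <= s by rewrite mulr_ge0 ?ler_piMr// ltW.
  set y := _ + s * _; set z := _ + - s * _.
  have [my yM] : m <= y /\ y <= M by rewrite /y; clear -sw1 sM; lra.
  have [mz zM] : m <= z /\ z <= M by rewrite /z; clear -sw2 sM; lra.
  have /andP[t0 t1] := t01; have t10 : 0 <= 1 - t by rewrite subr_ge0.
  have := ler_wpM2l t0 my; have := ler_wpM2l t0 yM.
  have := ler_wpM2l t10 mz; have := ler_wpM2l t10 zM.
  by clear; move=> ? ? ? ?; apply/andP; split; lra.
- rewrite /= G1c G2c k1c k2c w1c w2c subrr; split; by field.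
- rewrite /= k1d k2d w1d w2d -/L; split; last by field.
    by rewrite -[RHS]tf /g1 /g2; ring.
  have -> : s * th = h1 - h0 - m * L by [].
  have -> : - s * (L - th) = s * th - s * L by ring.
  by rewrite sth /s; ring.
Qed.

(** * Interpolation across a gap *)

(* Halving [x, y] repeatedly shows that a defect of second order is none. *)
Lemma nondecreasing_quadratic_defect (R : realType) (G : R -> R) (a b C : R) :
  (forall x y, a <= x -> x <= y -> y <= b -> - C * (y - x) ^+ 2 <= G y - G x) ->
  a <= b -> G a <= G b.
Proof.
move=> GC ab.
have halve n : forall x y, a <= x -> x <= y -> y <= b ->
    - (C / 2 ^+ n) * (y - x) ^+ 2 <= G y - G x.
  elim: n => [|n ih] x y ax xy yb; first by rewrite expr0 divr1; exact: GC.
  pose z := (x + y) / 2.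
  have xz : x <= z by rewrite /z; lra.
  have zy : z <= y by rewrite /z; lra.
  have := ih _ _ ax xz (le_trans zy yb); have := ih _ _ (le_trans ax xz) zy yb.
  rewrite [2 ^+ n.+1]exprS invfM; set D := C / 2 ^+ n.
  have -> : y - z = (y - x) / 2 by rewrite /z; field.
  have -> : z - x = (y - x) / 2 by rewrite /z; field.
  have -> : C * (2^-1 * (2 ^+ n)^-1) = D / 2 by rewrite /D; field; rewrite expf_neq0.
  by lra.
rewrite leNgt; apply/negP => Gba.
pose B := `|C| * (b - a) ^+ 2.
have B0 : 0 <= B by rewrite mulr_ge0 ?sqr_ge0.
pose n := Num.truncn (B / (G a - G b)).
have n0 : 0 < (2 : R) ^+ n by rewrite exprn_gt0.
have Bn : B < (G a - G b) * 2 ^+ n.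
  rewrite mulrC -ltr_pdivrMr ?subr_gt0//; apply: lt_le_trans (truncnS_gt _) _.
  by rewrite -natrX ler_nat ltn_expl.
have := ler_wpM2r (ltW n0) (halve n _ _ (lexx a) ab (lexx b)).
have -> : - (C / 2 ^+ n) * (b - a) ^+ 2 * 2 ^+ n = - (C * (b - a) ^+ 2).
  by rewrite mulrAC mulNr divfK ?gt_eqF// mulNr.
have : C * (b - a) ^+ 2 <= B by rewrite ler_wpM2r ?sqr_ge0 ?ler_norm.
by lra.
Qed.

(** An arbitrary selection of slopes of supporting lines. The inequality alone gives monotone slopes
    and, on a convex set, convexity, so the same notion serves for [f] and for the glued
    function. *)
Definition subgradient (R : realType) (D : set R) (f h : R -> R) :=
  forall x y, D x -> D y -> f x + h x * (y - x) <= f y.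

Lemma subgradient_nondecreasing (R : realType) (D : set R) (f h : R -> R) x y :
  subgradient D f h -> D x -> D y -> x <= y -> h x <= h y.
Proof.
move=> fh Dx Dy; rewrite le_eqVlt => /predU1P[->//|xy].
have fxy := fh _ _ Dx Dy; have fyx := fh _ _ Dy Dx.
have yx0 : 0 < y - x by rewrite subr_gt0.
by rewrite -(ler_pM2r yx0); lra.
Qed.

(** Integration of the bound on [h], without knowing that [h] is the derivative of [f]. On a short
    interval the subgradient inequality at the left end misses the affine bound by [s / 2] times the
    squared length, and such a defect disappears under subdivision. *)
Lemma subgradient_lower (R : realType) (f h : R -> R) (a b l s : R) :
  subgradient `[a, b] f h -> a <= b ->
  (forall x, a <= x <= b -> l + s * (x - a) <= h x) ->
  l * (b - a) + s * (b - a) ^+ 2 / 2 <= f b - f a.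
Proof.
move=> fh ab lh.
pose G x := f x - l * (x - a) - s * (x - a) ^+ 2 / 2.
suff /nondecreasing_quadratic_defect/(_ ab) : forall x y, a <= x -> x <= y ->
    y <= b -> - (s / 2) * (y - x) ^+ 2 <= G y - G x.
  by rewrite /G subrr; lra.
move=> x y ax xy yb; rewrite /G.
  have := fh x y; rewrite /= !in_itv/= ax yb (le_trans ax xy) (le_trans xy yb).
  move=> /(_ isT isT).
  have := lh x; rewrite ax (le_trans xy yb) => /(_ isT).
  rewrite -subr_ge0 => hx.
  have : 0 <= (h x - (l + s * (x - a))) * (y - x).
    by apply: mulr_ge0 => //; rewrite subr_ge0.
  by lra.
Qed.

(** The same argument, with the subgradient inequality taken at the right end of each short
    interval. *)
Lemma subgradient_upper (R : realType) (f h : R -> R) (a b l s : R) :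
  subgradient `[a, b] f h -> a <= b ->
  (forall x, a <= x <= b -> h x <= l + s * (x - a)) ->
  f b - f a <= l * (b - a) + s * (b - a) ^+ 2 / 2.
Proof.
move=> fh ab hl.
pose G x := l * (x - a) + s * (x - a) ^+ 2 / 2 - f x.
suff /nondecreasing_quadratic_defect/(_ ab) : forall x y, a <= x -> x <= y ->
    y <= b -> - (s / 2) * (y - x) ^+ 2 <= G y - G x.
  by rewrite /G subrr; lra.
move=> x y ax xy yb; rewrite /G.
  have := fh y x; rewrite /= !in_itv/= ax yb (le_trans ax xy) (le_trans xy yb).
  move=> /(_ isT isT).
  have := hl y; rewrite yb (le_trans ax xy) => /(_ isT).
  rewrite -subr_ge0 => hy.
  have : 0 <= (l + s * (y - a) - h y) * (y - x).
    by apply: mulr_ge0 => //; rewrite subr_ge0.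
  by lra.
Qed.

Lemma subgradientS (R : realType) (D D' : set R) (f h : R -> R) :
  D `<=` D' -> subgradient D' f h -> subgradient D f h.
Proof. by move=> DD fh x y /DD Dx /DD Dy; exact: fh. Qed.

Definition first_order_at_ends (R : realType) (h : R -> R) (c d p q e : R) :=
  [/\ `|p - q| <= e,
    forall x, c <= x <= d -> `|h x - h c - p * (x - c)| <= e * (x - c) &
    forall x, c <= x <= d -> `|h d - h x - q * (d - x)| <= e * (d - x)].

(** The middle term is the area under [h - h c]. For the lower bound the interval is cut at
    [d - th], with slope [m] starting from [c] and slope [M] going back from [d]; for the upper
    bound it is cut at [c + th] and the slopes are exchanged. *)
Lemma subgradient_area_bounds (R : realType) (f h : R -> R) (c d m M th : R) :
  subgradient `[c, d] f h -> 0 <= th <= d - c ->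
  (forall x, c <= x <= d -> m * (x - c) <= h x - h c <= M * (x - c)) ->
  (forall x, c <= x <= d -> m * (d - x) <= h d - h x <= M * (d - x)) ->
  m * (d - c - th) ^+ 2 / 2 + (h d - h c) * th - M * th ^+ 2 / 2 <=
    f d - f c - h c * (d - c) <=
  M * th ^+ 2 / 2 + (h d - h c) * (d - c - th) - m * (d - c - th) ^+ 2 / 2.
Proof.
move=> fh /andP[th0 thL] lo hi.
have sub x y : c <= x -> y <= d -> subgradient `[x, y] f h.
  move=> cx yd; apply: subgradientS fh => z; rewrite /= !in_itv/=.
  by move=> /andP[xz zy]; rewrite (le_trans cx xz) (le_trans zy yd).
apply/andP; split.
- pose z := d - th.
  have cz : c <= z by clear -thL; rewrite /z; lra.
  have zd : z <= d by clear -th0; rewrite /z; lra.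
  have := @subgradient_lower _ f h c z (h c) m (sub _ _ (lexx c) zd) cz.
  have := @subgradient_lower _ f h z d (h d - M * th) M (sub _ _ cz (lexx d)) zd.
  have -> : d - z = th by rewrite /z; ring.
  have -> : z - c = d - c - th by rewrite /z; ring.
  move=> I1 I2.
  have {}I1 : (h d - M * th) * th + M * th ^+ 2 / 2 <= f d - f z.
    apply: I1 => x /andP[zx xd].
    have /andP[_] := hi x (introT andP (conj (le_trans cz zx) xd)).
    by clear; rewrite /z; lra.
  have {}I2 : h c * (d - c - th) + m * (d - c - th) ^+ 2 / 2 <= f z - f c.
    apply: I2 => x /andP[cx xz].
    have /andP[+ _] := lo x (introT andP (conj cx (le_trans xz zd))).
    by clear; lra.
  by clear -I1 I2; lra.
- pose z := c + th.
  have cz : c <= z by clear -th0; rewrite /z; lra.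
  have zd : z <= d by clear -thL; rewrite /z; lra.
  have := @subgradient_upper _ f h c z (h c) M (sub _ _ (lexx c) zd) cz.
  have := @subgradient_upper _ f h z d (h d - m * (d - c - th)) m
    (sub _ _ cz (lexx d)) zd.
  have -> : d - z = d - c - th by rewrite /z; ring.
  have -> : z - c = th by rewrite /z; ring.
  move=> I1 I2.
  have {}I1 : f d - f z <=
      (h d - m * (d - c - th)) * (d - c - th) + m * (d - c - th) ^+ 2 / 2.
    apply: I1 => x /andP[zx xd].
    have /andP[+ _] := hi x (introT andP (conj (le_trans cz zx) xd)).
    by clear; rewrite /z; lra.
  have {}I2 : f z - f c <= h c * th + M * th ^+ 2 / 2.
    apply: I2 => x /andP[cx xz].
    have /andP[_] := lo x (introT andP (conj cx (le_trans xz zd))).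
    by clear; lra.
  by clear -I1 I2; lra.
Qed.

Lemma gap_interpolation (R : realType) (f h : R -> R) (c d p q e : R) :
  c < d -> 0 < e -> subgradient `[c, d] f h -> 0 <= p -> 0 <= q ->
  (h c = h d -> p = 0 /\ q = 0) -> first_order_at_ends h c d p q e ->
  exists G k w : R -> R, [/\ C2_triple G k w,
    forall x, c <= x <= d -> 0 <= w x /\ `|w x - p| <= 3 * e,
    [/\ G c = f c, k c = h c & w c = p] &
    [/\ G d = f d, k d = h d & w d = q]].
Proof.
move=> cd e0 fh p0 q0 hcd [pq hc hd].
have inI x : c <= x <= d -> `[c, d]%classic x by rewrite /= in_itv.
have Ic : `[c, d]%classic c by apply: inI; rewrite lexx ltW.
have Id : `[c, d]%classic d by apply: inI; rewrite lexx ltW.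
have hle x y : c <= x -> x <= y -> y <= d -> h x <= h y.
  move=> cx xy yd; apply: (subgradient_nondecreasing fh) => //; apply: inI.
    by rewrite cx (le_trans xy yd).
  by rewrite yd (le_trans cx xy).
pose L := d - c; have L0 : 0 < L by rewrite subr_gt0.
have := hle c d (lexx c) (ltW cd) (lexx d).
(* With equal end slopes the strict lower bound on [h d - h c] fails for every level [m >= 0]; here
   [f] is affine on the gap. *)
rewrite le_eqVlt => /predU1P[hcdE|hclt].
  have [-> ->] := hcd hcdE.
  exists (fun x => f c + h c * (x - c) + 0 * ((x - c) ^+ 2 / 2)),
    (fun x => h c + 0 * (x - c)), (fun=> 0).
  split; first exact: C2_triple_quadratic.
  - by move=> x _; rewrite subrr normr0 lexx mulr_ge0// ltW.
  - by rewrite subrr; split => //; ring.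
  - split => //; last by rewrite hcdE; ring.
    by have := fh _ _ Ic Id; have := fh _ _ Id Ic; rewrite -hcdE; lra.
pose m := Num.max 0 (p - 3 * e); pose M := p + 3 * e.
pose m1 := Num.max 0 (p - 2 * e); pose M1 := p + 2 * e.
have mP : 0 <= m /\ p - 3 * e <= m by rewrite !le_max !lexx orbT.
have m1P : 0 <= m1 /\ p - 2 * e <= m1 by rewrite !le_max !lexx orbT.
(* A level truncated at [0] need not be separated from [m1]. Strictness then comes from [h c < h d]
   and from the upper level. *)
have mm1 : m = 0 \/ m < m1.
  rewrite /m; have [_|] := leP (p - 3 * e) 0; [by left|right].
  by rewrite lt_max; apply/orP; right; lra.
have mlem1 : m <= m1 by case: mm1 => [->|/ltW//]; case: m1P.
have MM1 : M1 < M by rewrite /M /M1; lra.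
have mp : m <= p <= M.
  by rewrite ge_max p0 /M /=; apply/andP; split; lra.
move: (pq); rewrite ler_norml => /andP[pq1 pq2].
have mq : m <= q <= M.
  by rewrite ge_max q0 /M /=; apply/andP; split; lra.
have m1M1 : m1 <= M1 by rewrite ge_max /M1; apply/andP; split; lra.
have lo x : c <= x <= d -> m1 * (x - c) <= h x - h c <= M1 * (x - c).
  move=> /[dup] xcd /andP[cx xd].
  have := hc _ xcd; rewrite ler_norml => /andP[hx1 hx2].
  have ex : 0 <= e * (x - c) by apply: mulr_ge0; lra.
  apply/andP; split; last by rewrite /M1; lra.
  rewrite /m1; have [_|_] := leP (p - 2 * e) 0; last by lra.
  by rewrite mul0r subr_ge0 hle.
have hi x : c <= x <= d -> m1 * (d - x) <= h d - h x <= M1 * (d - x).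
  move=> /[dup] xcd /andP[cx xd].
  have := hd _ xcd; rewrite ler_norml => /andP[hx1 hx2].
  have ex : 0 <= (q - (p - e)) * (d - x) by apply: mulr_ge0; lra.
  have ex' : 0 <= (p + e - q) * (d - x) by apply: mulr_ge0; lra.
  apply/andP; split; last by rewrite /M1; lra.
  rewrite /m1; have [_|_] := leP (p - 2 * e) 0; last by lra.
  by rewrite mul0r subr_ge0 hle.
have /andP[A1 A2] := lo d (introT andP (conj (ltW cd) (lexx d))).
rewrite -/L in A1 A2.
have mA : m * L < h d - h c.
  case: mm1 => [->|mm1]; first by rewrite mul0r subr_gt0.
  by apply: lt_le_trans A1; rewrite ltr_pM2r.
have AM : h d - h c < M * L by apply: le_lt_trans A2 _; rewrite ltr_pM2r.
have mM : m < M by lra.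
pose s := M - m; have s0 : 0 < s by rewrite subr_gt0.
pose th := (h d - h c - m * L) / s.
have sth : s * th = h d - h c - m * L by rewrite /th mulrC divfK// gt_eqF.
have th0 : 0 < th by rewrite -(pmulr_rgt0 _ s0) sth; lra.
have thL : th < L by rewrite -(ltr_pM2l s0) sth /s; lra.
have AE : h d - h c = m * L + (M - m) * th by rewrite -/s sth; clear; ring.
(* Both area bounds beat the corresponding bang-bang value by [(m1 - m) * (L - th) ^+ 2 / 2 + (M -
   M1) * th ^+ 2 / 2]. *)
have sq1 : 0 <= (m1 - m) * (L - th) ^+ 2 by rewrite mulr_ge0 ?sqr_ge0 ?subr_ge0.
have sq2 : 0 < (M - M1) * th ^+ 2 by rewrite mulr_gt0 ?exprn_gt0 ?subr_gt0.
have thI : 0 <= th <= d - c by rewrite (ltW th0) (ltW thL).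
have /andP[T1 T2] := subgradient_area_bounds fh thI lo hi.
rewrite -/L AE in T1 T2.
have Tlo : m * L ^+ 2 / 2 + (M - m) * th ^+ 2 / 2 < f d - f c - h c * L.
  by apply: lt_le_trans T1; clear -sq1 sq2; lra.
have Thi : f d - f c - h c * L < M * L ^+ 2 / 2 - (M - m) * (L - th) ^+ 2 / 2.
  by apply: le_lt_trans T2 _; clear -sq1 sq2; lra.
have [|G [k [w [C b ec ed]]]] := @C2_interpolation R c d m M (f c) (h c) p (f d) (h d) q
  cd mM mp mq _ Tlo Thi; first by rewrite -/L mA AM.
exists G, k, w; split => // x xcd; have /andP[b1 b2] := b _ xcd.
split; first by case: mP => m0 _; exact: le_trans b1.
have {}b1 : p - 3 * e <= w x by case: mP => _ /le_trans; apply.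
by rewrite ler_norml; clear -b1 b2; rewrite /M in b2; apply/andP; split; lra.
Qed.

(** * Gluing *)

Section glue.
Context {R : realType} (D F : set R) (f h phi : R -> R).

Definition gap c d := [/\ F c, F d, c < d & forall x, c < x < d -> ~ F x].

Context (Dopen : forall x, D x ->
    exists2 r, 0 < r & forall y, `|y - x| < r -> D y)
  (Dconvex : forall x y z, D x -> D z -> x <= y <= z -> D y)
  (fh : subgradient D f h) (FD : F `<=` D)
  (Fclosed : forall x, D x -> ~ F x ->
    exists2 r, 0 < r & forall y, `|y - x| < r -> ~ F y)
  (Fcofinal : forall x, D x ->
    (exists2 y, F y & y < x) /\ (exists2 y, F y & x < y))
  (Fderive : forall x e, F x -> 0 < e -> exists2 r, 0 < r &
    forall x' y, F x' -> D y -> `|x' - x| < r -> `|y - x| < r ->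
      `|h y - h x' - phi x' * (y - x')| <= e * `|y - x'|).

Lemma h_nondecreasing x y : D x -> D y -> x <= y -> h x <= h y.
Proof. exact: (subgradient_nondecreasing fh). Qed.

(** In the sum of the expansion from [x] evaluated at [y] and the one from [y] evaluated at [x], the
    increments of [h] cancel and [(phi y - phi x) * (y - x)] remains. *)
Lemma phi_cvg x e : F x -> 0 < e -> exists2 r, 0 < r &
  forall y, F y -> `|y - x| < r -> `|phi y - phi x| <= e.
Proof.
move=> Fx e0; have e20 : 0 < e / 2 by lra.
have [r r0 hr] := Fderive Fx e20; exists r => // y Fy yx.
have [->|yNx] := eqVneq y x; first by rewrite subrr normr0 ltW.
have xx : `|x - x| < r by rewrite subrr normr0.
have := hr y x Fy (FD Fx) yx xx; have := hr x y Fx (FD Fy) xx yx.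
have yx0 : 0 < `|y - x| by rewrite normr_gt0 subr_eq0.
rewrite [`|x - y|]distrC => h1 h2.
rewrite -(ler_pM2r yx0) -normrM.
have -> : (phi y - phi x) * (y - x) = (h y - h x - phi x * (y - x)) +
  (h x - h y - phi y * (x - y)) by ring.
by apply: le_trans (ler_normD _ _) _; lra.
Qed.

Lemma D_right x r : D x -> 0 < r -> exists2 y, D y & x < y < x + r.
Proof.
move=> Dx r0; have [s s0 xs] := Dopen Dx.
have m0 : 0 < Num.min r s by rewrite lt_min r0.
have mr : Num.min r s <= r by rewrite ge_min lexx.
have ms : Num.min r s <= s by rewrite ge_min lexx orbT.
exists (x + Num.min r s / 2); last by lra.
apply: xs; have -> : x + Num.min r s / 2 - x = Num.min r s / 2 by ring.
by rewrite gtr0_norm; lra.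
Qed.

Lemma D_left x r : D x -> 0 < r -> exists2 y, D y & x - r < y < x.
Proof.
move=> Dx r0; have [s s0 xs] := Dopen Dx.
have m0 : 0 < Num.min r s by rewrite lt_min r0.
have mr : Num.min r s <= r by rewrite ge_min lexx.
have ms : Num.min r s <= s by rewrite ge_min lexx orbT.
exists (x - Num.min r s / 2); last by lra.
apply: xs; have -> : x - Num.min r s / 2 - x = - (Num.min r s / 2) by ring.
by rewrite normrN gtr0_norm; lra.
Qed.

Lemma phi_ge0 x : F x -> 0 <= phi x.
Proof.
move=> Fx; rewrite leNgt; apply/negP => p0.
have e0 : 0 < - phi x / 2 by lra.
have [r r0 hr] := Fderive Fx e0.
have [y Dy /andP[xy yr]] := D_right (FD Fx) r0.
have := hr x y Fx Dy; rewrite subrr normr0 gtr0_norm ?subr_gt0// => /(_ r0).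
have -> : y - x < r by lra.
move=> /(_ isT); rewrite ler_norml => /andP[_].
have : h x <= h y by apply: h_nondecreasing => //; [exact: FD|exact: ltW].
have : 0 < - phi x * (y - x) by rewrite mulr_gt0//; lra.
by lra.
Qed.

Lemma gapD c d x : gap c d -> c <= x <= d -> D x.
Proof. by case=> /FD Dc /FD Dd _ _; exact: Dconvex. Qed.

(** Here [h] is constant on the gap, and its derivative at either end can be computed from
    inside. *)
Lemma gap_phi0 c d : gap c d -> h c = h d -> phi c = 0 /\ phi d = 0.
Proof.
move=> gcd hcd; have [Fc Fd cd _] := gcd.
have hE x : c <= x <= d -> h x = h c.
  move=> /[dup] /(gapD gcd) Dx /andP[cx xd]; apply/eqP; rewrite eq_le.
  by rewrite {1}hcd !h_nondecreasing//; exact: FD.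
split; apply/eqP; rewrite eq_le phi_ge0// andbT leNgt; apply/negP => p0.
  have e0 : 0 < phi c / 2 by lra.
  have [r r0 hr] := Fderive Fc e0.
  pose t := Num.min (d - c) (r / 2).
  have t0 : 0 < t by rewrite lt_min subr_gt0 cd divr_gt0.
  have td : t <= d - c by rewrite ge_min lexx.
  have tr : t <= r / 2 by rewrite ge_min lexx orbT.
  have ctd : c <= c + t <= d by lra.
  have := hr c (c + t) Fc (gapD gcd ctd).
  have -> : c + t - c = t by ring.
  rewrite subrr normr0 gtr0_norm// => /(_ r0).
  have -> : t < r by lra.
  move=> /(_ isT); rewrite hE// subrr sub0r normrN gtr0_norm ?mulr_gt0//.
  by rewrite ler_pM2r//; lra.
have e0 : 0 < phi d / 2 by lra.
have [r r0 hr] := Fderive Fd e0.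
pose t := Num.min (d - c) (r / 2).
have t0 : 0 < t by rewrite lt_min subr_gt0 cd divr_gt0.
have td : t <= d - c by rewrite ge_min lexx.
have tr : t <= r / 2 by rewrite ge_min lexx orbT.
have ctd : c <= d - t <= d by lra.
have := hr d (d - t) Fd (gapD gcd ctd).
have -> : d - t - d = - t by ring.
rewrite subrr normr0 normrN gtr0_norm// => /(_ r0).
have -> : t < r by lra.
move=> /(_ isT); rewrite hE// hcd subrr sub0r mulrN opprK gtr0_norm ?mulr_gt0//.
by rewrite ler_pM2r//; lra.
Qed.

Lemma gap_exists x : D x -> ~ F x -> exists c d, gap c d /\ c < x < d.
Proof.
move=> Dx Fx; have [[y Fy yx] [z Fz xz]] := Fcofinal Dx.
pose A := [set t | F t /\ t < x]; pose B := [set t | F t /\ x < t].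
have A0 : A !=set0 by exists y.
have B0 : B !=set0 by exists z.
have Ax : ubound A x by move=> t [_ /ltW].
have Bx : lbound B x by move=> t [_ /ltW].
have hA : has_sup A by split => //; exists x.
have hB : has_inf B by split => //; exists x.
pose c := sup A; pose d := inf B.
have Ac t : A t -> t <= c by move=> At; apply: ub_le_sup => //; exists x.
have Bd t : B t -> d <= t by move=> Bt; apply: ge_inf => //; exists x.
have cx : c <= x by apply: ge_sup.
have xd : x <= d by apply: lb_le_inf.
have Dc : D c by apply: (Dconvex (FD Fy) Dx); rewrite Ac.
have Dd : D d by apply: (Dconvex Dx (FD Fz)); rewrite xd Bd.
have Fc : F c.
  apply: contrapT => /(Fclosed Dc)[r r0 rF].
  have [t At ct] := sup_adherent r0 hA.
  have := Ac _ At; rewrite le_eqVlt => /predU1P[tc|tc].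
    by case: At; rewrite tc => Fc _; apply: (rF c) => //; rewrite subrr normr0.
  by case: At => Ft _; apply: (rF t) => //; rewrite ltr0_norm; rewrite -/c in ct; lra.
have Fd : F d.
  apply: contrapT => /(Fclosed Dd)[r r0 rF].
  have [t Bt dt] := inf_adherent r0 hB.
  have := Bd _ Bt; rewrite le_eqVlt => /predU1P[td|td].
    by case: Bt; rewrite -td => Fd _; apply: (rF d) => //; rewrite subrr normr0.
  by case: Bt => Ft _; apply: (rF t) => //; rewrite gtr0_norm; rewrite -/d in dt; lra.
have {}cx : c < x by rewrite lt_neqAle cx andbT; apply/eqP => cx'; rewrite cx' in Fc.
have {}xd : x < d by rewrite lt_neqAle xd andbT; apply/eqP => xd'; rewrite -xd' in Fd.
exists c, d; split; last by rewrite cx.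
split => // [|t /andP[ct td] Ft]; first exact: lt_trans xd.
have [tx|xt|tx] := ltgtP t x.
- by have := Ac t; rewrite leNgt ct => /(_ (conj Ft tx)).
- by have := Bd t; rewrite leNgt td => /(_ (conj Ft xt)).
- by rewrite tx in Ft.
Qed.

Lemma gap_unique c d c' d' x :
  gap c d -> gap c' d' -> c < x < d -> c' < x < d' -> c = c' /\ d = d'.
Proof.
move=> [Fc Fd _ nF] [Fc' Fd' _ nF'] /andP[cx xd] /andP[c'x xd'].
split; apply/eqP; rewrite eq_le !leNgt; apply/andP; split; apply/negP => lt.
- by apply: (nF' c) => //; rewrite lt (lt_trans cx).
- by apply: (nF c') => //; rewrite lt (lt_trans c'x).
- by apply: (nF d') => //; rewrite lt (lt_trans cx).
- by apply: (nF' d) => //; rewrite lt (lt_trans c'x).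
Qed.


(** Some finite slope always works: close to an end the expansion holds with error slope 1, and at
    distance at least [r] the total increment [A] is at most [A / r] times the distance. *)
Lemma gap_first_order c d : gap c d ->
  exists2 e, 0 < e & first_order_at_ends h c d (phi c) (phi d) e.
Proof.
move=> gcd; have [Fc Fd cd _] := gcd.
have [r r0 hr] := Fderive Fc ltr01; have [s s0 hs] := Fderive Fd ltr01.
have pc := phi_ge0 Fc; have pd := phi_ge0 Fd.
pose A := h d - h c.
have hcd x : c <= x <= d -> h c <= h x /\ h x <= h d.
  move=> /[dup] /(gapD gcd) Dx /andP[cx xd].
  by split; apply: h_nondecreasing => //; exact: FD.
have A0 : 0 <= A.
  by rewrite subr_ge0; have [] := hcd d; rewrite ?lexx ?(ltW cd).
have Ar : 0 <= A / r by rewrite divr_ge0// ltW.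
have As : 0 <= A / s by rewrite divr_ge0// ltW.
exists (1 + A / r + A / s + phi c + phi d); first by lra.
split=> [|x xcd|x xcd].
- by rewrite ler_norml; apply/andP; split; lra.
- have /andP[cx xd] := xcd; have [hcx hxd] := hcd _ xcd.
  have x0 : 0 <= x - c by lra.
  have m1 : 0 <= A / s * (x - c) by rewrite mulr_ge0.
  have m2 : 0 <= A / r * (x - c) by rewrite mulr_ge0.
  have m3 : 0 <= phi c * (x - c) by rewrite mulr_ge0.
  have m4 : 0 <= phi d * (x - c) by rewrite mulr_ge0.
  have [xr|rx] := ltP (x - c) r.
    have := hr c x Fc (gapD gcd xcd); rewrite subrr normr0 (ger0_norm x0).
    by move=> /(_ r0 xr); lra.
  have : A / r * r <= A / r * (x - c) by rewrite ler_wpM2l.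
  rewrite divfK ?gt_eqF// => Ax.
  by rewrite ler_norml; apply/andP; split; rewrite /A in Ax m1 m2 A0 *; lra.
- have /andP[cx xd] := xcd; have [hcx hxd] := hcd _ xcd.
  have x0 : 0 <= d - x by lra.
  have m1 : 0 <= A / s * (d - x) by rewrite mulr_ge0.
  have m2 : 0 <= A / r * (d - x) by rewrite mulr_ge0.
  have m3 : 0 <= phi c * (d - x) by rewrite mulr_ge0.
  have m4 : 0 <= phi d * (d - x) by rewrite mulr_ge0.
  have -> : h d - h x - phi d * (d - x) = - (h x - h d - phi d * (x - d)) by ring.
  rewrite normrN.
  have [xs|sx] := ltP (d - x) s.
    have := hs d x Fd (gapD gcd xcd).
    rewrite subrr normr0 distrC (ger0_norm x0).
    by move=> /(_ s0 xs); lra.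
  have : A / s * s <= A / s * (d - x) by rewrite ler_wpM2l.
  rewrite divfK ?gt_eqF// => Ax.
  by rewrite ler_norml; apply/andP; split; rewrite /A in Ax m1 m2 A0 *; lra.
Qed.

(* The last clause of the second item makes the interpolant near-optimal for
   the deviation of [h] from its first order expansions at the ends. *)
Definition gap_interpolant c d (t : (R -> R) * (R -> R) * (R -> R)) :=
  [/\ C2_triple t.1.1 t.1.2 t.2,
    forall x, c <= x <= d -> 0 <= t.2 x /\
      forall e, 0 < e -> first_order_at_ends h c d (phi c) (phi d) e ->
        `|t.2 x - phi c| <= 3 * (e + (d - c)),
    [/\ t.1.1 c = f c, t.1.2 c = h c & t.2 c = phi c] &
    [/\ t.1.1 d = f d, t.1.2 d = h d & t.2 d = phi d]].

Lemma gap_interpolant_exists c d : gap c d -> exists t, gap_interpolant c d t.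
Proof.
move=> gcd; have [Fc Fd cd _] := gcd.
pose S := [set e | 0 < e /\ first_order_at_ends h c d (phi c) (phi d) e].
have hS : has_inf S.
  split; last by exists 0 => e [/ltW].
  by have [e e0 he] := gap_first_order gcd; exists e.
have dc0 : 0 < d - c by rewrite subr_gt0.
(* The infimum of the admissible slopes may be [0] or fail to be attained; the excess [d - c] is
   harmless because it tends to 0 along shrinking gaps. *)
have [e [e0 he] eS] := inf_adherent dc0 hS.
have fhcd : subgradient `[c, d] f h.
  by apply: subgradientS fh => x; rewrite /= in_itv/=; exact: gapD.
have [G [k [w [C wb ec ed]]]] := gap_interpolation cd e0 fhcd
  (phi_ge0 Fc) (phi_ge0 Fd) (gap_phi0 gcd) he.
exists (G, k, w); split => // x xcd; have [w0 we] := wb _ xcd; split => //.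
move=> e' e'0 he'; apply: (le_trans we).
have : inf S <= e' by apply: ge_inf => //; case: hS.
by lra.
Qed.

Lemma glue_exists : exists g k w : R -> R,
  (forall x, F x -> [/\ g x = f x, k x = h x & w x = phi x]) /\
  (forall c d, gap c d -> exists G k' w', [/\ C2_triple G k' w',
    forall x, c <= x <= d -> [/\ g x = G x, k x = k' x & w x = w' x] &
    forall x, c <= x <= d -> 0 <= w x /\
      forall e, 0 < e -> first_order_at_ends h c d (phi c) (phi d) e ->
        `|w x - phi c| <= 3 * (e + (d - c))]).
Proof.
have /choice[T TP] : forall cd, exists t,
    gap cd.1 cd.2 -> gap_interpolant cd.1 cd.2 t.
  move=> cd; have [gcd|ngcd] := pselect (gap cd.1 cd.2).
    by have [t ht] := gap_interpolant_exists gcd; exists t.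
  (* A dummy value: only pairs that are gaps are ever evaluated. *)
  by exists (f, f, f).
have /choice[E EP] : forall x, exists cd,
    D x -> ~ F x -> gap cd.1 cd.2 /\ cd.1 < x < cd.2.
  move=> x; have [Dx|nDx] := pselect (D x); last by exists (0, 0).
  have [Fx|nFx] := pselect (F x); first by exists (0, 0).
  by have [c [d gcd]] := gap_exists Dx nFx; exists (c, d).
pose g x := if pselect (F x) then f x else (T (E x)).1.1 x.
pose k x := if pselect (F x) then h x else (T (E x)).1.2 x.
pose w x := if pselect (F x) then phi x else (T (E x)).2 x.
exists g, k, w.
have FE x : F x -> [/\ g x = f x, k x = h x & w x = phi x].
  by rewrite /g /k /w; case: pselect.
split=> // c d gcd; have [Fc Fd cd nF] := gcd.
have [C wb [Gc kc wc] [Gd kd wd]] := TP (c, d) gcd.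
have TE x : c <= x <= d ->
    [/\ g x = (T (c, d)).1.1 x, k x = (T (c, d)).1.2 x & w x = (T (c, d)).2 x].
  move=> /andP[cx xd].
  have [->|xNc] := eqVneq x c; first by rewrite Gc kc wc; exact: FE.
  have [->|xNd] := eqVneq x d; first by rewrite Gd kd wd; exact: FE.
  have cxd : c < x < d by rewrite !lt_neqAle cx xd xNd eq_sym xNc.
  have Dx : D x by apply: (gapD gcd); rewrite cx xd.
  have [gE Ex] := EP _ Dx (nF _ cxd).
  have [E1 E2] := gap_unique gE gcd Ex cxd.
  have EE : E x = (c, d) by rewrite -E1 -E2 -surjective_pairing.
  rewrite /g /k /w; case: pselect => Fx; first by have := nF _ cxd Fx.
  by rewrite EE.
exists (T (c, d)).1.1, (T (c, d)).1.2, (T (c, d)).2; split => // x xcd.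
by have [_ _ ->] := TE _ xcd; exact: wb.
Qed.

Context (g k w : R -> R)
  (gF : forall x, F x -> [/\ g x = f x, k x = h x & w x = phi x])
  (ggap : forall c d, gap c d -> exists G k' w', [/\ C2_triple G k' w',
    forall x, c <= x <= d -> [/\ g x = G x, k x = k' x & w x = w' x] &
    forall x, c <= x <= d -> 0 <= w x /\
      forall e, 0 < e -> first_order_at_ends h c d (phi c) (phi d) e ->
        `|w x - phi c| <= 3 * (e + (d - c))]).

(** Although infinitely many gaps may lie between [x] and [y], three steps suffice: to the end of
    the gap of [x], from there to the start of the gap of [y] inside [F], and on to [y]. *)
Lemma chain_gaps (Q : R -> R -> Prop) :
  (forall x, Q x x) ->
  (forall x y z, x <= y -> y <= z -> Q x y -> Q y z -> Q x z) ->
  (forall x y, F x -> F y -> x < y -> Q x y) ->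
  (forall c d x y, gap c d -> c <= x -> x < y -> y <= d -> Q x y) ->
  forall x y, D x -> D y -> x <= y -> Q x y.
Proof.
move=> Qr Qt QF Qg.
have QFD x y : F x -> D y -> x <= y -> Q x y.
  move=> Fx Dy; rewrite le_eqVlt => /predU1P[->//|xy].
  have [Fy|/(gap_exists Dy)[c [d [gcd /andP[cy yd]]]]] := pselect (F y).
    exact: QF.
  have [Fc _ cd nF] := gcd.
  have xc : x <= c.
    by rewrite leNgt; apply/negP => cx; apply: (nF x) => //; rewrite cx (lt_trans xy).
  apply: (Qt _ c) => //; [exact: ltW| |by apply: (Qg c d) => //; exact: ltW].
  by move: xc; rewrite le_eqVlt => /predU1P[->//|]; exact: QF.
move=> x y Dx Dy; rewrite le_eqVlt => /predU1P[->//|xy].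
have [Fx|/(gap_exists Dx)[c [d [gcd /andP[cx xd]]]]] := pselect (F x).
  by apply: QFD => //; exact: ltW.
have [_ Fd _ _] := gcd.
have [yd|/ltW dy] := leP y d; first by apply: (Qg c d) => //; exact: ltW.
apply: (Qt _ d) => //; [exact: ltW| |exact: QFD].
by apply: (Qg c d) => //; exact: ltW.
Qed.

Lemma MVT_is_derive (u v : R -> R) x y : (forall z : R, is_derive z 1 u (v z)) ->
  x < y -> exists2 z, x < z < y & u y - u x = v z * (y - x).
Proof.
move=> uv xy; have cu : {within `[x, y], continuous u}.
  apply: continuous_subspaceT => z.
  by apply: differentiable_continuous; apply/derivable1_diffP; case: (uv z).
have [z] := MVT xy (fun z _ => uv z) cu.
by rewrite in_itv/= => xzy; exists z.
Qed.

(** The three inequalities together form a transitive relation. Between points of [F] it is the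
    subgradient inequality of [f]; inside a gap it follows from the mean value theorem and
    [w >= 0]. *)
Lemma glue_chain x y : D x -> D y -> x <= y ->
  [/\ k x <= k y, k x * (y - x) <= g y - g x & g y - g x <= k y * (y - x)].
Proof.
move: x y; apply: chain_gaps => [x|x y z xy yz [k1 l1 u1] [k2 l2 u2]|x y Fx Fy xy|].
- by rewrite !subrr !mulr0.
- have : 0 <= (k y - k x) * (z - y) by apply: mulr_ge0; lra.
  have : 0 <= (k z - k y) * (y - x) by apply: mulr_ge0; lra.
  by move=> ? ?; split; lra.
- have [-> -> _] := gF Fx; have [-> -> _] := gF Fy.
  split; first by apply: h_nondecreasing; [exact: FD|exact: FD|exact: ltW].
    by have := fh (FD Fx) (FD Fy); lra.
  by have := fh (FD Fy) (FD Fx); lra.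
- move=> c d x y /ggap[G [k' [w' [[Gk kw _] E wb]]]] cx xy yd.
  have kmono s t : c <= s -> s < t -> t <= d -> k' s <= k' t.
    move=> cs st td; have [z zst kst] := MVT_is_derive kw st.
    have czd : c <= z <= d by lra.
    rewrite -subr_ge0 kst; have [_ _ <-] := E _ czd.
    by rewrite mulr_ge0 ?subr_ge0 ?(ltW st)//; have [] := wb _ czd.
  have [|-> -> _] := E x; first by lra.
  have [|-> -> _] := E y; first by lra.
  have [z /andP[xz zy] ->] := MVT_is_derive Gk xy.
  have xy0 : 0 <= y - x by lra.
  split; first exact: kmono.
    by rewrite ler_wpM2r// kmono//; lra.
  by rewrite ler_wpM2r// kmono//; lra.
Qed.

Lemma glue_subgradient : subgradient D g k.
Proof.
move=> x y Dx Dy; have [xy|/ltW yx] := leP x y.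
  by have [] := glue_chain Dx Dy xy; lra.
by have [] := glue_chain Dy Dx yx; lra.
Qed.

Lemma C2_triple_cvg (G k' w' : R -> R) x e : C2_triple G k' w' -> 0 < e ->
  exists2 r, 0 < r & forall y, `|y - x| < r -> `|w' y - w' x| <= e.
Proof.
case=> _ _ cw e0; have /cvgrPdist_le/(_ _ e0)[r /= r0 hr] := cw x.
exists r => // y yx; rewrite distrC; apply: hr.
by rewrite /ball/= distrC.
Qed.

(* The gaps shrinking to [x] are handled at once: their two ends satisfy the
   first order estimates uniformly. *)
Lemma gap_near x e : F x -> 0 < e -> exists2 r, 0 < r &
  forall c d y, gap c d -> `|c - x| < r -> `|d - x| < r -> c < y < d ->
    `|w y - phi x| <= e.
Proof.
(* The gap data have error slope [2 * e'] and the gap is shorter than [2 * e'], so the total is at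
   most [3 * (2 * e' + 2 * e') + e' = 13 * e']. *)
move=> Fx e0; pose e' := e / 16; have e'0 : 0 < e' by rewrite /e'; lra.
have [r r0 hr] := Fderive Fx e'0; have [s s0 hs] := phi_cvg Fx e'0.
exists (Num.min e' (Num.min r s)); first by rewrite !lt_min e'0 r0.
move=> c d y gcd; rewrite !lt_min => /andP[ce /andP[cr cs]] /andP[de /andP[dr ds]].
move=> /andP[cy yd].
have [Fc Fd cd _] := gcd; have [G [k' [w' [_ _ wb]]]] := ggap gcd.
have hc := hs _ Fc cs; have hd := hs _ Fd ds.
have xr z : c <= z <= d -> `|z - x| < r.
  by move: cr dr; rewrite !ltr_norml; lra.
have fo : first_order_at_ends h c d (phi c) (phi d) (2 * e').
  split=> [|z zcd|z zcd].
  - have -> : phi c - phi d = (phi c - phi x) - (phi d - phi x) by ring.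
    by apply: le_trans (ler_normB _ _) _; lra.
  - have := hr c z Fc (gapD gcd zcd) cr (xr _ zcd).
    have /andP[cz zd] := zcd; rewrite [`|z - c|]ger0_norm ?subr_ge0//.
    have : 0 <= e' * (z - c) by apply: mulr_ge0; lra.
    by lra.
  - have := hr d z Fd (gapD gcd zcd) dr (xr _ zcd).
    have /andP[cz zd] := zcd; rewrite [`|z - d|]distrC [`|d - z|]ger0_norm ?subr_ge0//.
    have : 0 <= e' * (d - z) by apply: mulr_ge0; lra.
    have -> : h d - h z - phi d * (d - z) = - (h z - h d - phi d * (z - d)) by ring.
    by rewrite normrN; lra.
have cyd : c <= y <= d by lra.
have e'20 : 0 < 2 * e' by lra.
have [_ /(_ _ e'20 fo) wy] := wb _ cyd.
have -> : w y - phi x = (w y - phi c) + (phi c - phi x) by ring.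
apply: le_trans (ler_normD _ _) _.
by move: ce de; rewrite !ltr_norml /e' in wy hc *; lra.
Qed.

(** On each side, either a gap ends at [x] and its own weight is continuous, or points of [F] lie
    arbitrarily close to [x]. In the second case one such point confines all gaps between it and [x]
    to a small neighbourhood. *)
Lemma w_cvg_F x e : F x -> 0 < e -> exists2 r, 0 < r &
  forall y, D y -> `|y - x| < r -> `|w y - phi x| <= e.
Proof.
move=> Fx e0; have [r r0 hr] := gap_near Fx e0; have [s s0 hs] := phi_cvg Fx e0.
have wF y : F y -> `|y - x| < s -> `|w y - phi x| <= e.
  by move=> Fy; have [_ _ ->] := gF Fy; exact: hs.
have [rR rR0 hR] : exists2 r', 0 < r' &
    forall y, D y -> x < y < x + r' -> `|w y - phi x| <= e.
  have [[d gxd]|ngap] := pselect (exists d, gap x d).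
    have [G [k' [w' [C E _]]]] := ggap gxd; have [_ _ xd _] := gxd.
    have [r' r'0 hr'] := C2_triple_cvg x C e0.
    exists (Num.min r' (d - x)); first by rewrite lt_min r'0 subr_gt0.
    move=> y Dy /andP[xy]; rewrite -ltrBlDl lt_min => /andP[yr' yd].
    have [_ _ wx] := gF Fx; rewrite -wx.
    have [|_ _ ->] := E x; first by lra.
    have [|_ _ ->] := E y; first by lra.
    by apply: hr'; rewrite gtr0_norm; lra.
  have m0 : 0 < Num.min r s by rewrite lt_min r0.
  have [d Fd /andP[xd dm]] : exists2 d, F d & x < d < x + Num.min r s.
    have [y Dy /andP[xy ym]] := D_right (FD Fx) m0.
    have [Fy|/(gap_exists Dy)[c [d [gcd /andP[cy yd]]]]] := pselect (F y).
      by exists y; rewrite ?xy.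
    have [Fc _ _ nF] := gcd; exists c => //.
    rewrite (lt_trans cy ym) andbT ltNge; apply/negP => cx.
    move: cx; rewrite le_eqVlt => /predU1P[cx|cx].
      by apply: ngap; exists d; rewrite -cx.
    by apply: (nF x) => //; rewrite cx (lt_trans xy).
  move: dm; rewrite -ltrBlDl lt_min => /andP[dr ds].
  exists (d - x); first by rewrite subr_gt0.
  move=> y Dy /andP[xy]; rewrite subrKC => yd.
  have [Fy|/(gap_exists Dy)[c [d' [gcd /andP[cy yd']]]]] := pselect (F y).
    by apply: wF => //; rewrite gtr0_norm; lra.
  have [Fc Fd' _ nF] := gcd.
  have xc : x <= c.
    by rewrite leNgt; apply/negP => cx; apply: (nF x) => //; rewrite cx (lt_trans xy).
  have d'd : d' <= d.
    by rewrite leNgt; apply/negP => dd'; apply: (nF d) => //; rewrite dd' (lt_trans cy).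
  apply: (hr c d') => //; last by rewrite cy.
    by rewrite ger0_norm; lra.
  by rewrite ger0_norm; lra.
have [rL rL0 hL] : exists2 r', 0 < r' &
    forall y, D y -> x - r' < y < x -> `|w y - phi x| <= e.
  have [[c gcx]|ngap] := pselect (exists c, gap c x).
    have [G [k' [w' [C E _]]]] := ggap gcx; have [_ _ cx _] := gcx.
    have [r' r'0 hr'] := C2_triple_cvg x C e0.
    exists (Num.min r' (x - c)); first by rewrite lt_min r'0 subr_gt0.
    move=> y Dy /andP[]; rewrite ltrBlDl -ltrBlDr lt_min => /andP[yr' yc] yx.
    have [_ _ wx] := gF Fx; rewrite -wx.
    have [|_ _ ->] := E x; first by lra.
    have [|_ _ ->] := E y; first by lra.
    by apply: hr'; rewrite ltr0_norm; lra.
  have m0 : 0 < Num.min r s by rewrite lt_min r0.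
  have [c Fc /andP[]] : exists2 c, F c & x - Num.min r s < c < x.
    have [y Dy /andP[ym yx]] := D_left (FD Fx) m0.
    have [Fy|/(gap_exists Dy)[c [d [gcd /andP[cy yd]]]]] := pselect (F y).
      by exists y; rewrite ?ym.
    have [_ Fd _ nF] := gcd; exists d => //.
    rewrite (lt_trans ym yd)/= ltNge; apply/negP => xd.
    move: xd; rewrite le_eqVlt => /predU1P[xd|xd].
      by apply: ngap; exists c; rewrite xd.
    by apply: (nF x) => //; rewrite xd andbT (lt_trans cy).
  rewrite ltrBlDl -ltrBlDr lt_min => /andP[cr cs] cx.
  exists (x - c); first by rewrite subr_gt0.
  move=> y Dy /andP[]; rewrite subKr => cy yx.
  have [Fy|/(gap_exists Dy)[c' [d [gcd /andP[c'y yd]]]]] := pselect (F y).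
    by apply: wF => //; rewrite ltr0_norm; lra.
  have [Fc' Fd _ nF] := gcd.
  have dx : d <= x.
    by rewrite leNgt; apply/negP => xd; apply: (nF x) => //; rewrite xd (lt_trans c'y).
  have cc' : c <= c'.
    by rewrite leNgt; apply/negP => c'c; apply: (nF c) => //; rewrite c'c (lt_trans cy).
  apply: (hr c' d) => //; last by rewrite c'y.
    by rewrite ler0_norm; lra.
  by rewrite ler0_norm; lra.
exists (Num.min rL rR); first by rewrite lt_min rL0.
move=> y Dy; rewrite lt_min !ltr_norml => /andP[/andP[yl _] /andP[_ yr]].
have [yx|xy|->] := ltgtP y x.
- by apply: hL => //; lra.
- by apply: hR => //; lra.
- by have [_ _ ->] := gF Fx; rewrite subrr normr0 ltW.
Qed.

Lemma gap_nbhs (c d x : R) : c < x < d ->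
  exists2 r, 0 < r & forall y, `|y - x| < r -> c <= y <= d.
Proof.
move=> /andP[cx xd]; exists (Num.min (x - c) (d - x)).
  by rewrite lt_min !subr_gt0 cx.
by move=> y; rewrite lt_min !ltr_norml; lra.
Qed.

Lemma w_cvg x e : D x -> 0 < e -> exists2 r, 0 < r &
  forall y, D y -> `|y - x| < r -> `|w y - w x| <= e.
Proof.
move=> Dx e0.
have [Fx|/(gap_exists Dx)[c [d [gcd cxd]]]] := pselect (F x).
  by have [_ _ ->] := gF Fx; exact: w_cvg_F.
have [G [k' [w' [C E _]]]] := ggap gcd.
have [r r0 hr] := C2_triple_cvg x C e0.
have [s s0 hs] := gap_nbhs cxd.
exists (Num.min r s); first by rewrite lt_min r0.
move=> y Dy; rewrite lt_min => /andP[yr /hs ycd].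
have [|_ _ ->] := E x; first by apply: hs; rewrite subrr normr0.
by have [_ _ ->] := E _ ycd; exact: hr.
Qed.

(** For [x] in [F] and [y] in a gap, the increment is split at the end of that gap on the side of
    [x]: up to this end [k] is compared through [h], beyond it by the mean value theorem with [w]
    close to [phi x]. *)
Lemma k_derive x : D x -> is_derive x 1 k (w x).
Proof.
move=> Dx.
have [Fx|/(gap_exists Dx)[c [d [gcd cxd]]]] := pselect (F x); last first.
  have [G [k' [w' [[_ kw _] E _]]]] := ggap gcd.
  have [s s0 hs] := gap_nbhs cxd.
  have [|_ _ ->] := E x; first by apply: hs; rewrite subrr normr0.
  apply: near_eq_is_derive (kw x); exists s => //= y.
  by rewrite /ball/= distrC => /hs/E[].
have [_ kx ->] := gF Fx.
apply/is_derive1_epsP => e e0.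
have [r r0 hr] := Fderive Fx e0; have [s s0 hs] := w_cvg_F Fx e0.
have [t t0 ht] := Dopen Dx.
exists (Num.min t (Num.min r s)); first by rewrite !lt_min t0 r0.
move=> y; rewrite !lt_min => /andP[/ht Dy /andP[yr ys]].
have xx : `|x - x| < r by rewrite subrr normr0.
have kF z : F z -> `|z - x| < r ->
    `|k z - k x - phi x * (z - x)| <= e * `|z - x|.
  by move=> Fz zr; have [_ -> _] := gF Fz; rewrite kx; exact: hr _ _ _ (FD Fz) xx zr.
have [Fy|/(gap_exists Dy)[c [d [gcd /andP[cy yd]]]]] := pselect (F y); first exact: kF.
have [Fc Fd _ nF] := gcd.
have [G [k' [w' [[_ kw _] E _]]]] := ggap gcd.
have wz z : c < z < d -> `|z - x| < s -> `|w' z - phi x| <= e.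
  move=> /andP[cz zd] zs; have czd : c <= z <= d by lra.
  by have [_ _ <-] := E _ czd; apply: hs => //; exact: gapD czd.
have kstep u v : c <= u -> u < v -> v <= d ->
    (forall z, u < z < v -> `|z - x| < s) ->
    `|k v - k u - phi x * (v - u)| <= e * (v - u).
  move=> cu uv vd zs.
  have [|_ -> _] := E u; first by lra.
  have [|_ -> _] := E v; first by lra.
  have [z /andP[uz zv] ->] := MVT_is_derive kw uv.
  rewrite -mulrBl normrM (gtr0_norm (_ : 0 < v - u)); last by lra.
  rewrite ler_wpM2r//; first by lra.
  apply: wz; first by lra.
  by apply: zs; rewrite uz.
have [yx|xy|yx] := ltgtP y x; last by case: (nF y); rewrite ?cy// yx.
- have dx : d <= x.
    by rewrite leNgt; apply/negP => xd; apply: (nF x) => //; rewrite xd (lt_trans cy).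
  have e1 : `|y - x| = x - y by rewrite distrC gtr0_norm// subr_gt0.
  have e2 : `|d - x| = x - d by rewrite distrC ger0_norm// subr_ge0.
  rewrite e1 in yr ys *.
  have xdr : x - d < r by lra.
  have := kF d Fd; rewrite e2 => /(_ xdr) kd.
  have ky : `|k d - k y - phi x * (d - y)| <= e * (d - y).
    by apply: kstep => //; [exact: ltW|move=> z zyd; rewrite ltr_norml; lra].
  have -> : k y - k x - phi x * (y - x) =
      (k d - k x - phi x * (d - x)) - (k d - k y - phi x * (d - y)) by ring.
  by apply: le_trans (ler_normB _ _) _; lra.
- have xc : x <= c.
    by rewrite leNgt; apply/negP => cx; apply: (nF x) => //; rewrite cx (lt_trans xy).
  have e1 : `|y - x| = y - x by rewrite gtr0_norm// subr_gt0.
  have e2 : `|c - x| = c - x by rewrite ger0_norm// subr_ge0.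
  rewrite e1 in yr ys *.
  have xcr : c - x < r by lra.
  have := kF c Fc; rewrite e2 => /(_ xcr) kc.
  have ky : `|k y - k c - phi x * (y - c)| <= e * (y - c).
    by apply: kstep => //; [exact: ltW|move=> z zcy; rewrite ltr_norml; lra].
  have -> : k y - k x - phi x * (y - x) =
      (k c - k x - phi x * (c - x)) + (k y - k c - phi x * (y - c)) by ring.
  by apply: le_trans (ler_normD _ _) _; lra.
Qed.

(** [f] and [g] agree at [y], and to the right of it both run between the lines of slopes [h y] and
    [h z] through the common value. *)
Lemma glue_dist x y z : F y -> F z -> y <= x <= z ->
  `|f x - g x| <= (h z - h y) * (z - y).
Proof.
move=> Fy Fz /andP[yx xz]; have Dy := FD Fy; have Dz := FD Fz.
have Dx : D x by apply: (Dconvex Dy Dz); rewrite yx.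
have [gy ky _] := gF Fy; have [_ kz _] := gF Fz.
have f1 := fh Dy Dx; have f2 := fh Dx Dy.
have hxz := h_nondecreasing Dx Dz xz; have hyx := h_nondecreasing Dy Dx yx.
have [kyx] := glue_chain Dy Dx yx; rewrite gy ky => g1 g2.
have [kxz _ _] := glue_chain Dx Dz xz; rewrite kz in kxz.
have m1 : 0 <= (h z - h x) * (x - y) by apply: mulr_ge0; lra.
have m2 : 0 <= (h z - k x) * (x - y) by apply: mulr_ge0; lra.
have m3 : 0 <= (h z - h y) * (z - x) by apply: mulr_ge0; lra.
by rewrite ler_norml; apply/andP; split; lra.
Qed.

End glue.

(** * The set of coincidence *)

Lemma lebesgue_measure_geometric_cover (R : realType) (A : nat -> set R) (e : R) :
  0 <= e -> (forall j, (lebesgue_measure (A j) <= (e / (2 ^ j.+1)%:R)%:E)%E) ->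
  (lebesgue_measure (\bigcup_j A j) <= e%:E)%E.
Proof.
move=> e0 Ae; apply: (le_trans (lebesgue_measure_bigcup_le A)).
apply: le_trans (epsilon_trick0 xpredT e0).
by apply: lee_nneseries => // j _; exact: Ae.
Qed.

Fixpoint running_min (R : realType) (t : nat -> R) (n : nat) : R :=
  if n is n'.+1 then Num.min (running_min t n') (t n) else t 0%N.

Lemma running_min_gt0 (R : realType) (t : nat -> R) n :
  (forall i, 0 < t i) -> 0 < running_min t n.
Proof. by move=> t0; elim: n => //= n ih; rewrite lt_min ih t0. Qed.

Lemma running_min_le (R : realType) (t : nat -> R) i n :
  (i <= n)%N -> running_min t n <= running_min t i.
Proof.
elim: n => [|n ih]; first by rewrite leqn0 => /eqP ->.
by rewrite leq_eqVlt => /predU1P[->//|/ih]; rewrite /= ge_min => ->.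
Qed.

Lemma running_min_lb (R : realType) (t : nat -> R) i n :
  (i <= n)%N -> running_min t n <= t i.
Proof.
move=> /(running_min_le t)/le_trans; apply.
by case: i => //= i; rewrite ge_min lexx orbT.
Qed.

(* [F] is obtained by removing the open sets [`]u n, v n[ `\` K n]. Near a point
   of [`]u n, v n[] that belongs to no earlier interval only the sets with index
   at least [n.-1] are felt, and their total measure is less than the length
   [del n] allowed for the gaps there. *)
Section good_set.
Context {R : realType} (D : set R) (f h eps : R -> R) (u v : nat -> R) (eps0 : R).
Context (Dconvex : forall x y z, D x -> D z -> x <= y <= z -> D y)
  (fh : subgradient D f h)
  (ceps : {within D, continuous eps})
  (eps_gt0 : forall x, D x -> 0 < eps x)
  (eps0_gt0 : 0 < eps0)
  (uS : forall n, u n.+1 < u n) (vS : forall n, v n < v n.+1)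
  (uv : forall n, u n < v n) (Du : forall n, D (u n)) (Dv : forall n, D (v n))
  (Duv : forall x, D x -> exists n, u n < x < v n).

Let hnd x y : D x -> D y -> x <= y -> h x <= h y.
Proof. exact: (subgradient_nondecreasing fh). Qed.

Let DI n x : u n <= x <= v n -> D x.
Proof. exact: Dconvex. Qed.

(** The points of [F] chosen on either side of a point first captured by []u n, v n[] will be less
    than [2 * t] apart; multiplied by the oscillation of [h] on the next interval this must stay
    below [eps]. The other bounds keep the [t]-neighbourhood of [[u n, v n]] inside that next
    interval. *)
Lemma step_exists n : exists t, [/\ 0 < t, t <= u n - u n.+1, t <= v n.+1 - v n &
  forall y, u n.+1 <= y <= v n.+1 -> (h (v n.+1) - h (u n.+1)) * (2 * t) < eps y].
Proof.
have cI : {within `[u n.+1, v n.+1], continuous eps}.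
  by apply: continuous_subspaceW ceps => x /=; rewrite in_itv/=; exact: DI.
have [y yI emin] := EVT_min (ltW (uv n.+1)) cI.
have e0 : 0 < eps y by apply/eps_gt0/(@DI n.+1); move: yI; rewrite in_itv.
pose O := h (v n.+1) - h (u n.+1).
have O0 : 0 <= O by rewrite subr_ge0 hnd// ltW.
(* [O + 1] replaces [O], which may vanish. *)
pose s := eps y / (2 * (O + 1)) / 2.
have O1 : 0 < 2 * (O + 1) by lra.
have s0 : 0 < s by rewrite !divr_gt0.
pose t := Num.min s (Num.min (u n - u n.+1) (v n.+1 - v n)).
have t0 : 0 < t by rewrite !lt_min s0 !subr_gt0 uS vS.
have ts : t <= s by rewrite ge_min lexx.
exists t; split; [by []|by rewrite !ge_min lexx !orbT|by rewrite !ge_min lexx !orbT|].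
move=> x xI; have xmin : eps y <= eps x by apply: emin; rewrite in_itv.
apply: lt_le_trans xmin; rewrite -/O.
have : 2 * (O + 1) * s = eps y / 2 by rewrite /s; field; rewrite gt_eqF//; lra.
have : 2 * (O + 1) * t <= 2 * (O + 1) * s by rewrite ler_wpM2l// ltW.
by lra.
Qed.

(** [h] is known to be monotone only on [D]. Clipping the argument to [[u n, v n]] gives a monotone
    function on the line with the same derivative inside. *)
Lemma piece_exists n e : 0 < e -> exists K : set R, [/\ compact K,
  (lebesgue_measure (`]u n, v n[ `\` K) < e%:E)%E &
  forall eta, 0 < eta -> exists2 r, 0 < r & forall x y, K x ->
    u n < x < v n -> u n < y < v n -> `|y - x| < r ->
    `|h y - h x - h^`()%classic x * (y - x)| <= eta * `|y - x|].
Proof.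
move=> e0; pose H x := h (Num.max (u n) (Num.min x (v n))).
have clipI x : u n <= Num.max (u n) (Num.min x (v n)) <= v n.
  by rewrite le_max lexx/= ge_max ge_min lexx orbT (ltW (uv n)).
have Hnd : {homo H : x y / x <= y}.
  move=> x y xy; apply: hnd; [exact: DI (clipI _)|exact: DI (clipI _)|].
  have xy' : Num.min x (v n) <= Num.min y (v n).
    by rewrite le_min !ge_min xy lexx orbT.
  by rewrite ge_max !le_max lexx xy' orbT.
have HE x : u n <= x <= v n -> H x = h x.
  by move=> /andP[ux xv]; rewrite /H min_l// max_r.
have [K [cK _ Ke _ Kder]] := nondecreasing_uniform_derivable Hnd (uv n) e0.
exists K; split => // eta eta0; have [r r0 hr] := Kder _ eta0.
exists r => // x y Kx /andP[ux xv] /andP[uy yv] yx.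
have -> : h^`()%classic x = H^`()%classic x.
  rewrite !derive1E; apply: near_eq_derive; near=> z; rewrite HE//.
  apply/andP; split; apply: ltW.
    by near: z; exact: lt_nbhsr.
  by near: z; exact: lt_nbhsl.
by have := hr _ Kx _ yx; rewrite !HE// ?(ltW ux) ?(ltW xv) ?(ltW uy) ?(ltW yv).
Unshelve. all: by end_near. Qed.

Lemma good_set_exists : exists F : set R, [/\ F `<=` D,
  forall x, D x -> ~ F x -> exists2 r, 0 < r & forall y, `|y - x| < r -> ~ F y,
  forall x, D x -> exists y z,
    [/\ F y, F z, y < x < z & (h z - h y) * (z - y) < eps x],
  forall x e, F x -> 0 < e -> exists2 r, 0 < r &
    forall x' y, F x' -> D y -> `|x' - x| < r -> `|y - x| < r ->
      `|h y - h x' - h^`()%classic x' * (y - x')| <= e * `|y - x'| &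
  (lebesgue_measure (D `\` F) < eps0%:E)%E].
Proof.
have /choice[t tP] := step_exists.
have t0 i : 0 < t i by have [] := tP i.
pose del := running_min t.
have del0 n : 0 < del n by exact: running_min_gt0.
(* The geometric weights make the sets of index at least [n.-1] sum to at most [del n / 2], and all
   of them to at most [eps0 / 2]. The shift in [del n.+1] pays for starting at [n.-1]; the running
   minimum lets all later sets respect [del n]. *)
pose e n := Num.min (del n.+1) eps0 / 2 / (2 ^ n.+1)%:R.
have e0 n : 0 < e n by rewrite !divr_gt0// ?ltr0n ?expn_gt0// lt_min del0.
have /choice[K KP] := fun n => piece_exists n (e0 n).
pose A n : set R := `]u n, v n[ `\` K n.
pose F := [set x | D x /\ forall n, ~ A n x].
have FK n x : F x -> u n < x < v n -> K n x.
  move=> [_ /(_ n) nA] uxv; apply: contrapT => nK; apply: nA.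
  by split => //=; rewrite in_itv.
have lebA n : (lebesgue_measure (A n) <= (e n)%:E)%E.
  by have [_ /ltW] := KP n.
have cover z n J : (forall m, (m < n)%N -> ~ u m < z < v m) ->
  (forall y, J y -> [/\ D y, ~ F y & `|y - z| < del n]) ->
  (lebesgue_measure J <= (del n / 2)%:E)%E.
  move=> nmin JP.
  have Jsub : J `<=` \bigcup_j A (n.-1 + j)%N.
    move=> y /JP[Dy nFy yd].
    have [m Amy] : exists m, A m y.
      by apply: contrapT => nA; apply: nFy; split => // m Am; apply: nA; exists m.
    (* If [m.+1 < n], a point of []u m, v m[] within [t m] of [z] would put [z] in []u m.+1, v
       m.+1[], against the minimality of [n]. *)
    have nm : (n.-1 <= m)%N.
      rewrite leqNgt; apply/negP => mn.
      have mn' : (m.+1 < n)%N by rewrite -ltn_predRL.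
      apply: (nmin _ mn').
      have [+ _] := Amy; rewrite /= in_itv/= => /andP[uy yv].
      have dt : del n <= t m by apply: running_min_lb; exact: ltnW (ltnW mn').
      have [_ tu tv _] := tP m.
      by move: yd; rewrite ltr_norml; lra.
    by exists (m - n.-1)%N => //; rewrite subnKC.
  apply: (le_trans (le_lebesgue_measureT Jsub)).
  apply: lebesgue_measure_geometric_cover => [|j]; first by rewrite ltW// divr_gt0.
  apply: (le_trans (lebA _)); rewrite lee_fin /e.
  have p0 i : 0 < (2 ^ i)%:R :> R by rewrite ltr0n expn_gt0.
  apply: ler_pM.
  - by rewrite divr_ge0// ltW// lt_min del0.
  - by rewrite invr_ge0 ltW.
  - rewrite ler_pM2r// ge_min; apply/orP; left; apply: running_min_le.
    by rewrite -addSn; exact: leq_trans (leqSpred n) (leq_addr _ _).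
  - by rewrite lef_pV2 ?posrE// ler_nat leq_exp2l// ltnS leq_addl.
exists F; split.
- by move=> x [].
- move=> x Dx nFx.
  have [n [Inx nKx]] : exists n, A n x.
    by apply: contrapT => nA; apply: nFx; split => // n An; apply: nA; exists n.
  have oA : open (A n).
    apply: openI; first exact: interval_open.
    have [cK _ _] := KP n; apply: closed_openC.
    by apply: compact_closed => //; exact: norm_hausdorff.
  have := open_nbhs_nbhs (conj oA (conj Inx nKx)) => -[r /= r0 xr].
  exists r => // y yx [_ /(_ n)]; apply; apply: xr.
  by rewrite /ball/= distrC.
- move=> z Dz.
  have exn : exists n, u n < z < v n by exact: Duv.
  have nmin m : (m < ex_minn exn)%N -> ~ u m < z < v m.
    by case: ex_minnP => n _ nm mn /nm; rewrite leqNgt mn.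
  have zn : u (ex_minn exn) < z < v (ex_minn exn) by case: ex_minnP.
  move: (ex_minn exn) zn nmin => n zn nmin.
  have [_ tu tv teps] := tP n.
  have dn : del n <= t n by exact: running_min_lb.
  have d0 := del0 n.
  have D' y : z - del n < y < z + del n -> D y.
    by move=> yz; apply: (@DI n.+1); lra.
  have meet s : z - del n <= s <= z ->
      (* An interval of length [del n] that misses [F] would have measure at most [del n / 2]. *)
      exists2 y, F y & s < y < s + del n.
    move=> zs; apply: contrapT => nF.
    suff : (lebesgue_measure (`]s, (s + del n)%R[%classic : set R) <=
        (del n / 2)%:E)%E.
      rewrite lebesgue_measure_itv/= lte_fin ltrDl d0 -EFinB lee_fin => le.
      by lra.
    apply: (cover z n) => // y; rewrite /= in_itv/= => sy; split.
    - by apply: D'; lra.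
    - by move=> Fy; apply: nF; exists y.
    - by rewrite ltr_norml; lra.
  have [|y Fy yz] := meet (z - del n); first by lra.
  have [|x Fx zx] := meet z; first by lra.
  exists y, x; split => //; first by lra.
  have zI : u n.+1 <= z <= v n.+1 by lra.
  apply: le_lt_trans (teps _ zI).
  have hy : h (u n.+1) <= h y by apply: hnd; [exact: Du|by case: Fy|lra].
  have hx : h x <= h (v n.+1) by apply: hnd; [by case: Fx|exact: Dv|lra].
  have hyx : h y <= h x by apply: hnd; [by case: Fy|by case: Fx|lra].
  by apply: ler_pM; lra.
- move=> x eta Fx eta0; have [n /andP[un vn]] := Duv Fx.1.
  have [_ _ /(_ _ eta0)[r r0 hr]] := KP n.
  exists (Num.min r (Num.min (x - u n) (v n - x)) / 2).
    by rewrite divr_gt0// !lt_min r0 !subr_gt0 un vn.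
  have mr : Num.min r (Num.min (x - u n) (v n - x)) <= r by rewrite ge_min lexx.
  have mu : Num.min r (Num.min (x - u n) (v n - x)) <= x - u n.
    by rewrite !ge_min lexx orbT.
  have mv : Num.min r (Num.min (x - u n) (v n - x)) <= v n - x.
    by rewrite !ge_min lexx !orbT.
  move=> x' y Fx' Dy; rewrite !ltr_norml => /andP[x'1 x'2] /andP[y1 y2].
  have x'I : u n < x' < v n by lra.
  by apply: hr => //; [exact: FK|lra|rewrite ltr_norml; lra].
- have e00 := eps0_gt0.
  have sub : D `\` F `<=` \bigcup_n A n.
    move=> x [Dx nFx]; apply: contrapT => nA; apply: nFx; split => // n An.
    by apply: nA; exists n.
  apply: (le_lt_trans (le_lebesgue_measureT sub)).
  apply: (@le_lt_trans _ _ (eps0 / 2)%:E); last by rewrite lte_fin; lra.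
  apply: lebesgue_measure_geometric_cover => [|j]; first by lra.
  apply: (le_trans (lebA _)); rewrite lee_fin /e.
  by rewrite !ler_pM2r ?invr_gt0 ?ltr0n ?expn_gt0// ge_min lexx orbT.
Qed.

End good_set.

(** * Exhaustion of an open interval by bounded intervals *)

Lemma exhaustion_right (R : realType) (m : R) (b : \bar R) : (m%:E < b)%E ->
  exists v : nat -> R, [/\ m < v 0%N, forall n, v n < v n.+1,
    forall n, ((v n)%:E < b)%E & forall x, (x%:E < b)%E -> exists n, x < v n].
Proof.
case: b => [b| |//]; rewrite ?lte_fin => mb.
  exists (fun n => b - (b - m) / n.+2%:R).
  have bm : 0 < b - m by rewrite subr_gt0.
  split.
  - suff : (b - m) / 2%:R < b - m by lra.
    by rewrite ltr_pdivrMr// ltr_pMr// ltr1n.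
  - move=> n; rewrite ltrD2l ltrN2 ltr_pM2l// ltf_pV2 ?posrE//.
    by rewrite ltr_nat.
  - by move=> n; rewrite lte_fin gtrBl divr_gt0.
  - move=> x; rewrite lte_fin => xb.
    exists (Num.truncn ((b - m) / (b - x))).
    rewrite ltrBrDl -ltrBrDr ltr_pdivrMr// mulrC -ltr_pdivrMr ?subr_gt0//.
    by apply: lt_trans (truncnS_gt _) _; rewrite ltr_nat.
exists (fun n => m + n.+1%:R); split.
- by rewrite ltrDl.
- by move=> n; rewrite ltrD2l ltr_nat.
- by move=> n; rewrite ltry.
- move=> x _; exists (Num.truncn (x - m)).
  by rewrite -ltrBlDl; exact: truncnS_gt.
Qed.

Lemma exhaustion (R : realType) (a b : \bar R) : (a < b)%E ->
  exists u v : nat -> R, [/\ forall n, u n.+1 < u n, forall n, v n < v n.+1,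
    forall n, u n < v n, forall n, ooitv a b (u n) /\ ooitv a b (v n) &
    forall x, ooitv a b x -> exists n, u n < x < v n].
Proof.
move=> ab; have [m /andP[am mb]] : exists m : R, (a < m%:E < b)%E.
  case: a b ab => [a| |] [b| |] //; rewrite ?lte_fin => ab.
  - by exists ((a + b) / 2); rewrite !lte_fin; apply/andP; split; lra.
  - by exists (a + 1); rewrite lte_fin ltry ltrDl ltr01.
  - by exists (b - 1); rewrite lte_fin ltNyr gtrBl ltr01.
  - by exists 0; rewrite ltNyr ltry.
have [v [v0 vS vb vx]] := exhaustion_right mb.
(* The left ends come from the right exhaustion of the reflected interval. *)
have : ((- m)%:E < - a)%E by rewrite EFinN lteN2.
move=> /exhaustion_right[u [u0 uS ub ux]].
have au n : (a < (- u n)%:E)%E by rewrite EFinN lteNr.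
have vm n : m < v n by elim: n => // n /lt_trans; apply.
have um n : - u n < m.
  by rewrite ltrNl; elim: n => // n /lt_trans; apply.
have vmono : {homo v : i j / (i <= j)%N >-> i <= j}.
  by apply: homo_leq => [//|? ? ?|n]; [exact: le_trans|exact: ltW].
have umono : {homo u : i j / (i <= j)%N >-> i <= j}.
  by apply: homo_leq => [//|? ? ?|n]; [exact: le_trans|exact: ltW].
exists (fun n => - u n), v; split => //.
- by move=> n; rewrite ltrN2.
- by move=> n; exact: lt_trans (vm n).
- move=> n; rewrite /ooitv/= au vb/=; split.
    by apply: lt_trans mb; rewrite lte_fin.
  by rewrite andbT; apply: (lt_trans am); rewrite lte_fin.
- move=> x /andP[ax xb].
  have [i xi] := vx _ xb; have [|j xj] := ux (- x); first by rewrite EFinN lteN2.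
  exists (maxn i j); apply/andP; split.
    by rewrite ltrNl; apply: lt_le_trans xj _; apply: umono; exact: leq_maxr.
  by apply: lt_le_trans xi _; apply: vmono; exact: leq_maxl.
Qed.

(** * Convex functions and subgradients *)

Lemma subgradient_convex (R : realType) (D : set R) (g k : R -> R) :
  (forall x y z, D x -> D z -> x <= y <= z -> D y) ->
  subgradient D g k -> convex_function D g.
Proof.
move=> Dc gk t x y /set_mem Dx /set_mem Dy;
have s0 : 0 <= t%:inum by []. have s1 : t%:inum <= 1 by [].
pose s := t%:inum; rewrite -/s in s0 s1.
suff : g (s * x + (1 - s) * y) <= s * g x + (1 - s) * g y by [].
set z := s * x + _.
have Dz : D z.
  have [xy|/ltW yx] := leP x y.
    by apply: (Dc x z y) => //; rewrite /z; apply/andP; split; nra.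
  by apply: (Dc y z x) => //; rewrite /z; apply/andP; split; nra.
have := ler_wpM2l s0 (gk _ _ Dz Dx).
have s10 : 0 <= 1 - s by rewrite subr_ge0.
have := ler_wpM2l s10 (gk _ _ Dz Dy).
have : s * (k z * (x - z)) + (1 - s) * (k z * (y - z)) = 0 by rewrite /z; ring.
by lra.
Qed.

Lemma convex_three_points (R : realType) (D : set R) (f : R -> R) x y z :
  convex_function D f -> D x -> D z -> x < y < z ->
  f y * (z - x) <= (z - y) * f x + (y - x) * f z.
Proof.
move=> cf Dx Dz /andP[xy yz].
have zx : 0 < z - x by lra.
pose s := (z - y) / (z - x).
have s0 : 0 <= s by apply: divr_ge0; lra.
have s1 : s <= 1 by rewrite ler_pdivrMr//; lra.
have : f (s * x + (1 - s) * z) <= s * f x + (1 - s) * f z.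
  exact: cf (Itv01 s0 s1) x z (mem_set Dx) (mem_set Dz).
have -> : s * x + (1 - s) * z = y by rewrite /s; field; rewrite gt_eqF.
move=> /(ler_wpM2r (ltW zx)) /le_trans; apply.
by rewrite le_eqVlt; apply/orP; left; apply/eqP; rewrite /s; field; rewrite gt_eqF.
Qed.

(** The infimum of the difference quotients to the right, that is the right derivative, serves as
    [h]. It is finite because [D] is open, so quotients to the left bound it from below. *)
Lemma convex_subgradient (R : realType) (D : set R) (f : R -> R) :
  (forall x, D x -> exists2 r, 0 < r & forall y, `|y - x| < r -> D y) ->
  convex_function D f -> exists h, subgradient D f h.
Proof.
move=> Do cf.
pose S x := [set s | exists z, [/\ D z, x < z & s = (f z - f x) / (z - x)]].
have S0 x : D x -> S x !=set0.
  move=> Dx; have [r r0 xr] := Do _ Dx.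
  exists ((f (x + r / 2) - f x) / (x + r / 2 - x)), (x + r / 2).
  split=> //; last by lra.
  by apply: xr; rewrite gtr0_norm; lra.
have Sl x y s : D x -> D y -> y < x -> S x s -> (f x - f y) / (x - y) <= s.
  move=> Dx Dy yx [z [Dz xz ->]].
  have yxz : y < x < z by rewrite yx.
  have := convex_three_points cf Dy Dz yxz.
  rewrite ler_pdivrMr ?subr_gt0// mulrAC ler_pdivlMr ?subr_gt0//; lra.
exists (fun x => inf (S x)) => x y Dx Dy.
have [xy|yx|<-] := ltgtP x y; last by rewrite subrr mulr0 addr0.
  have xy0 : 0 < y - x by rewrite subr_gt0.
  have lb : has_lbound (S x).
    have [r r0 xr] := Do _ Dx.
    have Dr : D (x - r / 2) by apply: xr; rewrite ltr0_norm; lra.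
    exists ((f x - f (x - r / 2)) / (x - (x - r / 2))) => s; apply: Sl => //; lra.
  have : inf (S x) <= (f y - f x) / (y - x) by apply: ge_inf => //; exists y.
  by rewrite ler_pdivlMr//; lra.
have xy0 : 0 < x - y by rewrite subr_gt0.
have : (f x - f y) / (x - y) <= inf (S x).
  by apply: lb_le_inf; [exact: S0|move=> s; exact: Sl].
by rewrite ler_pdivrMr//; lra.
Qed.

(** The remainder [g y - g x - k x * (y - x)] lies between 0 and [(k y - k x) * (y - x)], which is
    of second order because [k] is derivable at [x]. *)
Lemma subgradient_is_derive (R : realType) (D : set R) (g k : R -> R) (x l r : R) :
  0 < r -> (forall y, `|y - x| < r -> D y) -> subgradient D g k ->
  is_derive x 1 k l -> is_derive x 1 g (k x).
Proof.
move=> r0 rD gk /is_derive1_epsP/(_ _ ltr01)[s s0 hs].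
apply/is_derive1_epsP => e e0; pose C := 1 + `|l|.
have C0 : 0 < C by rewrite ltr_wpDr.
exists (Num.min r (Num.min s (e / C))); first by rewrite !lt_min r0 s0 divr_gt0.
move=> y; rewrite !lt_min => /andP[yr /andP[ys ye]].
have Dy := rD _ yr; have Dx : D x by apply: rD; rewrite subrr normr0.
have g1 := gk _ _ Dx Dy; have g2 := gk _ _ Dy Dx.
have kC : `|k y - k x| <= C * `|y - x|.
  have -> : k y - k x = (k y - k x - l * (y - x)) + l * (y - x) by ring.
  apply: le_trans (ler_normD _ _) _; rewrite normrM /C.
  by have := hs _ ys; lra.
rewrite ger0_norm; last by lra.
apply: (@le_trans _ _ ((k y - k x) * (y - x))); first by lra.
apply: le_trans (ler_norm _) _; rewrite normrM ler_wpM2r//.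
by apply: (le_trans kC); rewrite mulrC -ler_pdivlMr// ltW.
Qed.

Theorem theorem1p3 (R : realType) (a b : \bar R) (f : R -> R) :
  (a < b)%E ->
  convex_function (ooitv a b) f ->
  forall eps0 : R, 0 < eps0 ->
  forall eps : R -> R,
    {within ooitv a b, continuous eps} ->
    {in ooitv a b, forall x, 0 < eps x} ->
  exists g : R -> R,
    [/\ convex_function (ooitv a b) g,
        C2_on (ooitv a b) g,
        (lebesgue_measure [set x | ooitv a b x /\ f x <> g x] < eps0%:E)%E &
        {in ooitv a b, forall x, `|f x - g x| < eps x}].
Proof.
move=> ab cf eps0 eps00 eps ceps epsP; pose D := ooitv a b.
have oD : open D.
  rewrite (_ : D = [set x | (a < x%:E)%E] `&` [set x | (x%:E < b)%E]).
    by apply: openI; [exact: open_ereal_gt|exact: open_ereal_lt].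
  by apply/seteqP; split => x /= => [/andP|[? ?]] //; apply/andP.
have Do x : D x -> exists2 r, 0 < r & forall y, `|y - x| < r -> D y.
  move=> Dx; have := open_nbhs_nbhs (conj oD Dx) => -[r /= r0 xr].
  by exists r => // y yx; apply: xr; rewrite /ball/= distrC.
have Dc x y z : D x -> D z -> x <= y <= z -> D y.
  move=> /andP[ax _] /andP[_ zb] /andP[xy yz]; apply/andP; split.
    by apply: lt_le_trans ax _; rewrite lee_fin.
  by apply: le_lt_trans zb; rewrite lee_fin.
have [h fh] := convex_subgradient Do cf.
have [u [v [uS vS uv Duv Dexh]]] := exhaustion ab.
have eps_gt0 x : D x -> 0 < eps x by move=> Dx; apply: epsP; rewrite inE.
have [F [FD Fcl Fd Fder Fmeas]] := good_set_exists Dc fh ceps eps_gt0 eps00 uS vS uv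
  (fun n => (Duv n).1) (fun n => (Duv n).2) Dexh.
have Fcof x : D x -> (exists2 y, F y & y < x) /\ (exists2 y, F y & x < y).
  move=> /Fd[y [z [Fy Fz /andP[yx xz] _]]].
  by split; [exists y|exists z].
have [g [k [w [gF ggap]]]] := glue_exists Do Dc fh FD Fcl Fcof Fder.
have gk : subgradient D g k.
  exact: (glue_subgradient Dc fh FD Fcl Fcof gF ggap).
(* The second derivative is obtained before the first: derivability of [k] is what turns the
   subgradient [k] into the derivative of [g]. *)
have kder x : D x -> is_derive x 1 k (w x).
  exact: (k_derive Do Dc FD Fcl Fcof Fder gF ggap).
have gder x : D x -> is_derive x 1 g (k x).
  by move=> Dx; have [r r0 rD] := Do _ Dx; exact: (subgradient_is_derive r0 rD gk (kder _ Dx)).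
have nearD (P : R -> Prop) x : D x -> (forall y, D y -> P y) -> \forall y \near x, P y.
  by move=> Dx DP; have := open_nbhs_nbhs (conj oD Dx); apply: filterS.
have g'E x : D x -> g^`()%classic x = k x.
  by move=> /gder[_ <-]; rewrite derive1E.
have g'der x : D x -> is_derive x 1 g^`()%classic (w x).
  move=> Dx; apply: near_eq_is_derive (kder _ Dx).
  by apply: nearD Dx _ => y /g'E ->.
have g''E x : D x -> g^`(2)%classic x = w x.
  by move=> /g'der[_ <-]; rewrite derive1nS derive1n1 derive1E.
exists g; split.
- exact: subgradient_convex gk.
- split=> [x /set_mem /gder[]//|x /set_mem /g'der[]//|].
  apply: continuous_in_subspaceT => x /set_mem Dx.
  apply/cvgrPdist_le => e e0.
  have [r r0 hr] := w_cvg Do Dc FD Fcl Fcof Fder gF ggap Dx e0.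
  have [s s0 sD] := Do _ Dx.
  exists (Num.min r s) => /=; first by rewrite lt_min r0.
  move=> y; rewrite /ball/= distrC lt_min => /andP[yr /sD Dy].
  suff : `|g^`(2)%classic x - g^`(2)%classic y| <= e by [].
  by rewrite !g''E// distrC; exact: hr.
- apply: le_lt_trans Fmeas; apply: le_lebesgue_measureT => x /= [Dx fgx].
  by split => // /gF[gx _ _]; apply: fgx.
- move=> x /set_mem Dx; have [y [z [Fy Fz /andP[yx xz] hyz]]] := Fd _ Dx.
  apply: le_lt_trans hyz; apply: (glue_dist Dc fh FD Fcl Fcof gF ggap Fy Fz).
  by rewrite !ltW.
Qed.
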